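(* Let $-\infty<A<B<\infty$ and let $\mu_0,\mu_1\in(A,B)$ with $\mu_1>\mu_0$. Let $\mathscr{P}$ be the set of Borel probability measures on $[A,B]$, and let $\alpha_{\min}=(\mu_0-B)^{-1}$, $\alpha_{\max}=(\mu_0-A)^{-1}$, $I_{\mu_0}=[\alpha_{\min},\alpha_{\max}]$. For $\alpha\in I_{\mu_0}$ let $E_\alpha:[A,B]\to\mathbb{R}$, $E_\alpha(x)=1+\alpha(x-\mu_0)$. In the following three cases the GROW e-variable $E^{\mathrm{GW}}$ and the REGROW e-variable $E^{\mathrm{RGW}}$ (indexed by the alternative) exist. (a) For the null hypothesis $\mathcal{P}=\{P\in\mathscr{P}\mid \mathbb{E}_P[X]=\mu_0\}$ against the alternative $\mathcal{Q}=\{Q\in\mathscr{P}\mid \mathbb{E}_Q[X]=\mu_1\}$, we have $E^{\mathrm{GW}}_{\mathcal{Q}}=E_{\alpha^\star_{\mathrm{GW}}}$ and $E^{\mathrm{RGW}}_{\mathcal{Q}}=E_{\alpha^\star_{\mathrm{RGW}}}$, with $$\alpha^\star_{\mathrm{GW}}=\frac{\mu_1-\mu_0}{(\mu_0-A)(B-\mu_0)}\in(0,\alpha_{\max}),$$ and $\alpha^\star_{\mathrm{RGW}}$ the unique solution of $F_{\alpha^\star_{\mathrm{RGW}},\alpha_{\max}}(\mu_1)=G_{\alpha^\star_{\mathrm{RGW}},\alpha^\star_{\mathrm{GW}}}(\mu_1)$ with $\alpha^\star_{\mathrm{RGW}}>\alpha^\star_{\mathrm{GW}}$. (b) For the null hypothesis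 $\tilde{\mathcal{P}}=\{P\in\mathscr{P}\mid \mathbb{E}_P[X]\leq\mu_0\}$ against the alternative $\tilde{\mathcal{Q}}=\{Q\in\mathscr{P}\mid \mathbb{E}_Q[X]>\mu_1\}$, we have $E^{\mathrm{GW}}_{\tilde{\mathcal{Q}}}=E_{\alpha^\star_{\mathrm{GW}}}$ and $E^{\mathrm{RGW}}_{\tilde{\mathcal{Q}}}=E_{\tilde\alpha^\star_{\mathrm{RGW}}}$, with $\alpha^\star_{\mathrm{GW}}$ given by the same formula as in (a) and $$\tilde\alpha^\star_{\mathrm{RGW}}=\frac{(B-\mu_0)-\frac{(\mu_0-A)(B-\mu_1)}{B-A}\,r}{(\mu_0-A)(B-\mu_0)\left(1+\frac{B-\mu_1}{B-A}\,r\right)}\in(0,\alpha_{\max}),\qquad r=\left(\frac{\mu_1-A}{B-A}\right)^{\frac{\mu_1-A}{B-\mu_1}}.$$ (c) For the null hypothesis $\mathcal{P}=\{P\in\mathscr{P}\mid \mathbb{E}_P[X]=\mu_0\}$ against the alternative $\hat{\mathcal{Q}}=\{Q\in\mathscr{P}\mid \mathbb{E}_Q[X]\neq\mu_0\}$, the GROW e-variable is trivial, $E^{\mathrm{GW}}_{\hat{\mathcal{Q}}}\equiv1$, while $E^{\mathrm{RGW}}_{\hat{\mathcal{Q}}}=E_{\hat\alpha^\star_{\mathrm{RGW}}}$, for $$\hat\alpha^\star_{\mathrm{RGW}}=\frac{(A+B)/2-\mu_0}{(\mu_0-A)(B-\mu_0)}\in I_{\mu_0}.$$ Moreover, for any $\delta>0$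 such that $(\mu_0-\delta,\mu_0+\delta)\subseteq(A,B)$, for the null hypothesis $\mathcal{P}$ against the alternative $\hat{\mathcal{Q}}_\delta=\{Q\in\mathscr{P}\mid |\mathbb{E}_Q[X]-\mu_0|>\delta\}$, we still have $E^{\mathrm{GW}}_{\hat{\mathcal{Q}}_\delta}\equiv1$ and $E^{\mathrm{RGW}}_{\hat{\mathcal{Q}}_\delta}=E_{\hat\alpha^\star_{\mathrm{RGW}}}$, with the same $\hat\alpha^\star_{\mathrm{RGW}}$, independently of $\delta$.
   Context: The interval $[A,B]$ carries its Borel $\sigma$-field; $\mathbb{E}_P[f]=\mathbb{E}_P[f(X)]=\int_A^B f(x)\,dP(x)$, so $\mathbb{E}_P[X]$ is the mean of $P$. E-variables. For a null hypothesis $\mathcal{P}_0\subseteq\mathscr{P}$, an e-variable for $\mathcal{P}_0$ is a Borel measurable function $E:[A,B]\to\mathbb{R}$ with $E\geq0$ and $\mathbb{E}_P[E]\leq1$ for all $P\in\mathcal{P}_0$. The set of all e-variables for $\mathcal{P}_0$ is denoted $\mathcal{E}(\mathcal{P}_0)$. Expected log-growth. For $Q\in\mathscr{P}$ and an e-variable $E$, the e-power is $\mathbb{E}_Q[\log E]$, with $\log 0=-\infty$ and the convention $\mathbb{E}_Q[\log E]=-\infty$ whenever $\mathbb{E}_Q[\max\{0,-\log E\}]=\infty$. Put $\mathrm{GRO}(Q)=\sup_{E\in\mathcal{E}(\mathcal{P}_0)}\mathbb{E}_Q[\log E]$ (depending on the null $\mathcal{P}_0$). GROW and REGROW. For a null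 $\mathcal{P}_0$ and an alternative $\mathcal{Q}_0\subseteq\mathscr{P}$, let $$\mathrm{GROW}(\mathcal{Q}_0)=\sup_{E\in\mathcal{E}(\mathcal{P}_0)}\inf_{Q\in\mathcal{Q}_0}\mathbb{E}_Q[\log E],\qquad \mathrm{REGROW}(\mathcal{Q}_0)=\sup_{E\in\mathcal{E}(\mathcal{P}_0)}\inf_{Q\in\mathcal{Q}_0}\mathbb{E}_Q[\log E-\mathrm{GRO}(Q)].$$ If a maximiser $E\in\mathcal{E}(\mathcal{P}_0)$ for $\mathrm{GROW}(\mathcal{Q}_0)$ exists, it is called the GROW e-variable under $\mathcal{Q}_0$ and denoted $E^{\mathrm{GW}}_{\mathcal{Q}_0}$; if a maximiser for $\mathrm{REGROW}(\mathcal{Q}_0)$ exists, it is called the REGROW e-variable and denoted $E^{\mathrm{RGW}}_{\mathcal{Q}_0}$. Auxiliary functions. For $\alpha,\beta\in I_{\mu_0}$ and $x\in[A,B]$, $$f_\alpha(x)=\log\big(1+\alpha(x-\mu_0)\big),\qquad F_{\alpha,\beta}(x)=f_\alpha(x)-f_\beta(x)=\log\left(\frac{1+\alpha(x-\mu_0)}{1+\beta(x-\mu_0)}\right),$$ $$G_{\alpha,\beta}(x)=\frac{(B-x)F_{\alpha,\beta}(A)+(x-A)F_{\alpha,\beta}(B)}{B-A},$$ with the conventions $\log 0=-\infty$ and $0/0=1$.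
   Formalization: In the last part of (c) the closed interval [μ0−δ, μ0+δ], not just the open one, is required to lie in (A,B); if exactly one endpoint equals A or B the alternative is one-sided and the claim fails (e.g. A=0, B=1, μ0=0.6, δ=0.4). *)

(* Defs.v *)
(* MathComp-Analysis; R : realType plays the role of the real numbers. *)
From mathcomp Require Import all_boot all_order all_algebra.
From mathcomp Require Import all_classical all_reals all_analysis.
Set Implicit Arguments.
Unset Strict Implicit.
Unset Printing Implicit Defensive.
Import Order.TTheory GRing.Theory Num.Theory.
Local Open Scope classical_set_scope.
Local Open Scope ring_scope.

(* A Borel probability measure on [A, B] is represented by a Borel probability
   measure on the line that gives mass 1 to [A, B]; accordingly only the
   restriction to [A, B] of a function E : R -> R is ever used. *)
Definition borel_prob (R : realType) := probability (measurableTypeR R) R.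

Definition probs_on (R : realType) (A B : R) : set (borel_prob R) :=
  [set P : borel_prob R | P [set` `[A, B]] = 1%E].

(* The library sets \int f = \int f^+ - \int f^- with +oo - +oo = -oo, so the
   value is -oo as soon as the integral of the negative part is infinite. *)
Definition expect (R : realType) (A B : R) (P : borel_prob R)
    (f : R -> \bar R) : \bar R :=
  (\int[P]_(x in [set` `[A, B]%R]) f x)%E.

Definition mean (R : realType) (A B : R) (P : borel_prob R) : \bar R :=
  expect A B P (fun x => x%:E).

Definition evars (R : realType) (A B : R) (P0 : set (borel_prob R)) :
    set (R -> R) :=
  [set E : R -> R |
    [/\ measurable_fun [set` `[A, B]] E,
        (forall x, A <= x <= B -> 0 <= E x) &
        (forall P, P0 P -> (expect A B P (fun x => (E x)%:E) <= 1)%E)]].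

(* lne 0%:E = -oo *)
Definition epower (R : realType) (A B : R) (Q : borel_prob R) (E : R -> R) :
    \bar R :=
  expect A B Q (fun x => lne (E x)%:E).

Definition GRO (R : realType) (A B : R) (P0 : set (borel_prob R))
    (Q : borel_prob R) : \bar R :=
  ereal_sup [set epower A B Q E | E in evars A B P0].

Definition worst_epower (R : realType) (A B : R) (Q0 : set (borel_prob R))
    (E : R -> R) : \bar R :=
  ereal_inf [set epower A B Q E | Q in Q0].

Definition worst_regret (R : realType) (A B : R) (P0 Q0 : set (borel_prob R))
    (E : R -> R) : \bar R :=
  ereal_inf
    [set expect A B Q (fun x => lne (E x)%:E - GRO A B P0 Q)%E | Q in Q0].

Definition GROW (R : realType) (A B : R) (P0 Q0 : set (borel_prob R)) :
    \bar R :=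
  ereal_sup [set worst_epower A B Q0 E | E in evars A B P0].

Definition REGROW (R : realType) (A B : R) (P0 Q0 : set (borel_prob R)) :
    \bar R :=
  ereal_sup [set worst_regret A B P0 Q0 E | E in evars A B P0].

(* Maximisers need not be unique as functions on [A, B]: lowering a maximiser
   slightly at one interior point can leave the worst case unchanged. *)
Definition is_GROW (R : realType) (A B : R) (P0 Q0 : set (borel_prob R))
    (E : R -> R) : Prop :=
  evars A B P0 E /\ worst_epower A B Q0 E = GROW A B P0 Q0.

Definition is_REGROW (R : realType) (A B : R) (P0 Q0 : set (borel_prob R))
    (E : R -> R) : Prop :=
  evars A B P0 E /\ worst_regret A B P0 Q0 E = REGROW A B P0 Q0.

Definition alpha_min (R : realType) (B mu0 : R) : R := (mu0 - B)^-1.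
Definition alpha_max (R : realType) (A mu0 : R) : R := (mu0 - A)^-1.

Definition I_ (R : realType) (A B mu0 : R) : set R :=
  [set` `[alpha_min B mu0, alpha_max A mu0]].

Definition E_ (R : realType) (mu0 alpha : R) : R -> R :=
  fun x => 1 + alpha * (x - mu0).

(* Quotient of nonnegative reals with 0/0 = 1 and a/0 = +oo for a > 0. *)
Definition quot (R : realType) (a b : R) : \bar R :=
  if b == 0 then (if a == 0 then 1%E else +oo%E) else (a / b)%:E.

Definition F_ (R : realType) (mu0 alpha beta : R) (x : R) : \bar R :=
  lne (quot (E_ mu0 alpha x) (E_ mu0 beta x)).

Definition G_ (R : realType) (A B mu0 alpha beta : R) (x : R) : \bar R :=
  (((B - x)%:E * F_ mu0 alpha beta A + (x - A)%:E * F_ mu0 alpha beta B)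
     * ((B - A)^-1)%:E)%E.

Definition alpha_GW (R : realType) (A B mu0 mu1 : R) : R :=
  (mu1 - mu0) / ((mu0 - A) * (B - mu0)).

Definition r_ (R : realType) (A B mu1 : R) : R :=
  ((mu1 - A) / (B - A)) `^ ((mu1 - A) / (B - mu1)).

Definition alpha_RGW_onesided (R : realType) (A B mu0 mu1 : R) : R :=
  ((B - mu0) - (mu0 - A) * (B - mu1) / (B - A) * r_ A B mu1)
  / ((mu0 - A) * (B - mu0) * (1 + (B - mu1) / (B - A) * r_ A B mu1)).

Definition alpha_RGW_twosided (R : realType) (A B mu0 : R) : R :=
  ((A + B) / 2 - mu0) / ((mu0 - A) * (B - mu0)).

Definition mean_eq (R : realType) (A B m : R) : set (borel_prob R) :=
  probs_on A B `&` [set P | mean A B P = m%:E].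

Definition mean_le (R : realType) (A B m : R) : set (borel_prob R) :=
  probs_on A B `&` [set P | (mean A B P <= m%:E)%E].

Definition mean_gt (R : realType) (A B m : R) : set (borel_prob R) :=
  probs_on A B `&` [set P | (m%:E < mean A B P)%E].

Definition mean_neq (R : realType) (A B m : R) : set (borel_prob R) :=
  probs_on A B `&` [set P | mean A B P <> m%:E].

Definition mean_far (R : realType) (A B m delta : R) : set (borel_prob R) :=
  probs_on A B `&` [set P | (delta%:E < `|mean A B P - m%:E|)%E].

(* Main.v *)
(** An e-variable for the null {mean = mu0}, tested on two-point laws of mean
    mu0, lies below an affine function E_alpha, so only the E_alpha compete.
    The adversaries are Dirac masses and laws on {A, B}. A Dirac mass punishes a
    small alpha. The law on {A, B} with mean mu1 punishes an alpha that is too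
    large, because its log-growth is concave in alpha, with maximum at alpha_GW.
    The REGROW slope equalizes the two regrets. Conversely, the regret of this
    E_alpha against E_beta is the mean of log (E_alpha / E_beta): when
    0 <= beta <= alpha this function is increasing and concave, hence above its
    chord on [A, B]; when alpha <= beta it is decreasing and convex, hence above
    its tangent at mu1 and above its value at B. In the two-sided case the Dirac
    masses at A and B both give regret log 2 at the candidate, and twice the
    candidate dominates every E_beta. *)
Require Import Defs.
From HB Require Import structures.
From mathcomp Require Import all_boot all_order all_algebra.
From mathcomp Require Import all_classical all_reals all_analysis.
From mathcomp Require Import measurable_realfun ring lra.
Set Implicit Arguments.
Unset Strict Implicit.
Unset Printing Implicit Defensive.
Import Order.TTheory GRing.Theory Num.Theory.
Import numFieldNormedType.Exports.
Local Open Scope classical_set_scope.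
Local Open Scope ring_scope.

(** * Monotonicity and measurability for extended-real integrands *)

Lemma integral_mono d (T : measurableType d) (R : realType)
    (mu : {measure set T -> \bar R}) (D : set T) (f g : T -> \bar R) :
  measurable D -> measurable_fun D f -> measurable_fun D g ->
  (forall x, D x -> (f x <= g x)%E) ->
  (\int[mu]_(x in D) f x <= \int[mu]_(x in D) g x)%E.
Proof.
(* Positive and negative parts are compared separately, since a log-growth may take the value -oo
   and fail to be integrable. *)
move=> mD mf mg fg; rewrite integralE [leRHS]integralE; apply: leeB.
  apply: ge0_le_integral => //; try exact: measurable_funepos.
  by move=> x Dx; rewrite !funeposE ge_max !le_max fg// lexx orbT.
apply: ge0_le_integral => //; try exact: measurable_funeneg.
by move=> x Dx; rewrite !funenegE ge_max !le_max leeN2 fg// lexx orbT.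
Qed.

Lemma measurable_lne (R : realType) (D : set (measurableTypeR R))
    (f : R -> R) :
  measurable D -> measurable_fun D f ->
  measurable_fun D (fun x => lne (f x)%:E).
Proof.
move=> mD mf.
suff mlne : measurable_fun [set: R] (fun r : R => lne r%:E).
  exact: (measurableT_comp mlne mf).
apply: measurable_fun_ifT => //; first exact: measurable_fun_ler.
by apply/measurable_EFinP; exact: measurable_ln.
Qed.

(** * Two-point laws *)

Section TwoPoint.
Variable R : realType.

Definition pick2 (x y : R) (b : bool) : measurableTypeR R := if b then y else x.

Lemma measurable_pick2 (x y : R) : measurable_fun [set: bool] (pick2 x y).
Proof. by []. Qed.

HB.instance Definition _ (x y : R) :=
  isMeasurableFun.Build _ _ _ _ (pick2 x y) (measurable_pick2 x y).

(** For [t] in [0, 1]: mass [1 - t] at [x] and [t] at [y]. With [t = 0] and [y = x] this is a Dirac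
    mass, so one family supplies every adversary. *)
Definition twopt (t x y : R) : borel_prob R :=
  distribution (bernoulli_prob t) (pick2 x y).

End TwoPoint.

(** * Expectations over [A, B]: two-point laws and bounded measurable functions *)

Section Interval.
Variables (R : realType) (A B : R).
Notation D := ([set` `[A, B]] : set (measurableTypeR R)).

Lemma mem_itvP (x : R) : D x <-> A <= x <= B.
Proof. by rewrite /= in_itv. Qed.

Lemma expect_twopt (t x y : R) (f : R -> \bar R) :
  A <= x <= B -> A <= y <= B -> measurable_fun D f ->
  expect A B (twopt t x y) f = (\int[bernoulli_prob t]_b f (pick2 x y b))%E.
Proof.
move=> xAB yAB mf; rewrite /expect integralE [RHS]integralE.
have pT : pick2 x y @^-1` D = setT.
  by apply/seteqP; split=> // b _; apply/mem_itvP; case: b.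
congr (_ - _)%E.
- rewrite (@ge0_integral_pushforward _ _ _ _ _ _ (measurable_pick2 x y)) ?pT//.
  + by rewrite -funepos_comp.
  + exact: measurable_funepos.
- rewrite (@ge0_integral_pushforward _ _ _ _ _ _ (measurable_pick2 x y)) ?pT//.
  + by rewrite -funeneg_comp.
  + exact: measurable_funeneg.
Qed.

Lemma integral_bernoulli_real (t : R) (f : bool -> R) : 0 <= t <= 1 ->
  (\int[bernoulli_prob t]_b (f b)%:E)%E
  = ((1 - t) * f false + t * f true)%:E.
Proof.
move=> t01; rewrite integralE !integral_bernoulli_prob//.
rewrite /unstable.onem !funeposE !funenegE -!EFinN -!EFin_max -!EFinM -!EFinD.
have maxB (a : R) : Num.max a 0 - Num.max (- a) 0 = a.
  by rewrite /Num.max; do !case: ltP => ?; lra.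
by congr (_%:E); rewrite -[f false in RHS]maxB -[f true in RHS]maxB; ring.
Qed.

Lemma expect_twopt_real (t x y : R) (f : R -> R) :
  A <= x <= B -> A <= y <= B -> 0 <= t <= 1 -> measurable_fun D f ->
  expect A B (twopt t x y) (fun z => (f z)%:E)
  = ((1 - t) * f x + t * f y)%:E.
Proof.
move=> xAB yAB t01 mf; rewrite expect_twopt//; last exact/measurable_EFinP.
by rewrite (integral_bernoulli_real (fun b => f (pick2 x y b))).
Qed.

(** Real bounds at the two points stand in for values that may be -oo, as the log of an e-variable
    is wherever it vanishes. *)
Lemma expect_twopt_le (t x y u v : R) (f : R -> \bar R) :
  A <= x <= B -> A <= y <= B -> 0 <= t <= 1 -> measurable_fun D f ->
  (f x <= u%:E)%E -> (f y <= v%:E)%E ->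
  (expect A B (twopt t x y) f <= ((1 - t) * u + t * v)%:E)%E.
Proof.
move=> xAB yAB t01 mf fx fy; rewrite expect_twopt//.
rewrite -(integral_bernoulli_real (fun b : bool => if b then v else u))//.
by apply: integral_mono => // -[].
Qed.

Lemma expect_twopt_ge (t x y u v : R) (f : R -> \bar R) :
  A <= x <= B -> A <= y <= B -> 0 <= t <= 1 -> measurable_fun D f ->
  (u%:E <= f x)%E -> (v%:E <= f y)%E ->
  (((1 - t) * u + t * v)%:E <= expect A B (twopt t x y) f)%E.
Proof.
move=> xAB yAB t01 mf fx fy; rewrite expect_twopt//.
rewrite -(integral_bernoulli_real (fun b : bool => if b then v else u))//.
by apply: integral_mono => // -[].
Qed.

Lemma twopt_probs_on (t x y : R) :
  A <= x <= B -> A <= y <= B -> probs_on A B (twopt t x y).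
Proof.
move=> xAB yAB; rewrite /probs_on /= /distribution /pushforward.
rewrite (_ : _ @^-1` _ = setT) ?probability_setT//.
by apply/seteqP; split=> // b _; apply/mem_itvP; case: b.
Qed.

Lemma mean_twopt (t x y : R) : A <= x <= B -> A <= y <= B -> 0 <= t <= 1 ->
  mean A B (twopt t x y) = ((1 - t) * x + t * y)%:E.
Proof. by move=> xAB yAB t01; rewrite /mean (expect_twopt_real (f := id)). Qed.

(** A class on which the expectation under every law carried by [A, B] is real and linear. *)
Definition regular (g : R -> R) :=
  measurable_fun D g /\ exists M, forall x, A <= x <= B -> `|g x| <= M.

Lemma regular_cst (k : R) : regular (fun=> k).
Proof. by split=> //; exists `|k|. Qed.

Lemma regular_id : regular id.
Proof.
split=> //; exists (Num.max `|A| `|B|) => x /andP[Ax xB].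
by rewrite le_max !ler_normr !ler_norml; lra.
Qed.

Lemma regularD (f g : R -> R) :
  regular f -> regular g -> regular (fun x => f x + g x).
Proof.
move=> [mf [M fM]] [mg [N gN]]; split; first exact: measurable_funD.
exists (M + N) => x xAB; rewrite (le_trans (ler_normD _ _))// lerD//.
  exact: fM.
exact: gN.
Qed.

Lemma regularM (f g : R -> R) :
  regular f -> regular g -> regular (fun x => f x * g x).
Proof.
move=> [mf [M fM]] [mg [N gN]]; split; first exact: measurable_funM.
exists (M * N) => x xAB; rewrite normrM ler_pM//.
  exact: fM.
exact: gN.
Qed.

Section Prob.
Variables (Q : borel_prob R).
Hypothesis Q1 : probs_on A B Q.

(** [fine] sends infinite values to 0, so this is the true expectation only when that is finite, as
    for every [regular] function. *)
Definition ev (g : R -> R) : R := fine (expect A B Q (fun x => (g x)%:E)).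

Lemma regular_integrable (g : R -> R) :
  regular g -> Q.-integrable D (EFin \o g).
Proof.
move=> [mg [M gM]]; apply: measurable_bounded_integrable => //.
  by rewrite [ltLHS]Q1 ltry.
exists M; split; first exact: num_real.
by move=> N MN x xD /=; rewrite (le_trans _ (ltW MN))// gM//; apply/mem_itvP.
Qed.

Lemma expectE (g : R -> R) : regular g ->
  expect A B Q (fun x => (g x)%:E) = (ev g)%:E.
Proof.
by move=> rg; rewrite /ev fineK//; apply/integrable_fin_num/regular_integrable.
Qed.

Lemma evD (f g : R -> R) : regular f -> regular g ->
  ev (fun x => f x + g x) = ev f + ev g.
Proof. by move=> rf rg; apply: RintegralD => //; exact: regular_integrable. Qed.

Lemma evZ (k : R) (g : R -> R) : regular g -> ev (fun x => k * g x) = k * ev g.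
Proof. by move=> rg; apply: RintegralZl => //; exact: regular_integrable. Qed.

Lemma ev_cst (k : R) : ev (fun=> k) = k.
Proof. by rewrite /ev /expect [LHS]Rintegral_cst// [X in fine X]Q1 mulr1. Qed.

Lemma meanE : mean A B Q = (ev id)%:E.
Proof. exact: (expectE regular_id). Qed.

(** Stating the domination through [expR] covers the zeros of [E], where the log is -oo and the
    bound is trivial. *)
Lemma epower_le (E g : R -> R) : measurable_fun D E -> regular g ->
  (forall x, A <= x <= B -> E x <= expR (g x)) ->
  (epower A B Q E <= (ev g)%:E)%E.
Proof.
move=> mE rg Eg; rewrite -expectE//; apply: integral_mono => //.
- exact: measurable_lne.
- by case: rg => mg _; exact/measurable_EFinP.
- move=> x /mem_itvP xAB; rewrite /lne; case: ifPn => [_|].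
    by rewrite leNye.
  rewrite -ltNge => Ex0.
  by rewrite lee_fin -(expRK (g x)) ler_ln ?posrE ?expR_gt0// Eg.
Qed.

End Prob.
End Interval.

(** * E-variables: the affine family, domination by it, and the maximin criterion *)

Section EVariables.
Variables (R : realType) (A B mu0 : R).
Hypothesis mu0AB : A < mu0 < B.
Notation D := ([set` `[A, B]] : set (measurableTypeR R)).
Notation E := (E_ mu0).

Lemma I_E (a : R) : I_ A B mu0 a <-> 0 <= E a A /\ 0 <= E a B.
Proof.
have [Amu muB] := andP mu0AB.
rewrite /I_ /= in_itv /= /alpha_min /alpha_max /E_.
rewrite -[(mu0 - B)^-1]opprK -invrN opprB lerNl.
rewrite -[(mu0 - A)^-1]div1r -[(B - mu0)^-1]div1r !ler_pdivlMr ?subr_gt0//.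
by split=> [/andP[? ?]|[? ?]]; [split|apply/andP; split]; lra.
Qed.

Lemma E_conv (a x : R) :
  E a x = (B - x) / (B - A) * E a A + (x - A) / (B - A) * E a B.
Proof.
have mAB := mu0AB.
by rewrite /E_; field; rewrite subr_eq0 gt_eqF//; lra.
Qed.

Lemma E_ge0 (a x : R) : 0 <= E a A -> 0 <= E a B -> A <= x <= B -> 0 <= E a x.
Proof.
move=> EA EB /andP[Ax xB]; have [Amu muB] := andP mu0AB.
by rewrite E_conv addr_ge0// mulr_ge0// divr_ge0//; lra.
Qed.

Lemma E_minr (a x : R) : A <= x <= B -> Num.min (E a A) (E a B) <= E a x.
Proof.
rewrite /E_ => xAB.
rewrite ge_min; have [a0|/ltW a0] := leP 0 a; apply/orP; [left|right].
  by rewrite lerD2l ler_wpM2l//; lra.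
by rewrite lerD2l ler_wnM2l//; lra.
Qed.

Lemma E_gt0 (a x : R) : 0 < E a A -> 0 < E a B -> A <= x <= B -> 0 < E a x.
Proof.
by move=> EA EB xAB; rewrite (lt_le_trans _ (E_minr a xAB))// lt_min EA.
Qed.

Lemma regular_E (a : R) : regular A B (E a).
Proof.
apply: regularD; first exact: regular_cst.
apply: regularM; first exact: regular_cst.
by apply: regularD; [exact: regular_id|exact: regular_cst].
Qed.

(** Positivity at both ends keeps the affine [E a] above a positive constant, its smaller end value,
    so its log is bounded. *)
Lemma regular_ln_E (a : R) : 0 < E a A -> 0 < E a B ->
  regular A B (fun x => ln (E a x)).
Proof.
move=> EA EB; have [mE [M ME]] := regular_E a.
split; first exact: measurableT_comp.
exists (`|ln (Num.min (E a A) (E a B))| + `|ln M|) => x xAB.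
have E_alpha0 := E_gt0 EA EB xAB.
have m0 : 0 < Num.min (E a A) (E a B) by rewrite lt_min EA.
have EM : E a x <= M by rewrite (le_trans (ler_norm _))// ME.
have l1 : ln (Num.min (E a A) (E a B)) <= ln (E a x).
  by rewrite ler_ln ?posrE ?E_minr.
have l2 : ln (E a x) <= ln M by rewrite ler_ln ?posrE// (lt_le_trans E_alpha0).
rewrite ler_norml; apply/andP; split.
  rewrite opprD; have := ler_norm (- ln (Num.min (E a A) (E a B))).
  by rewrite normrN; have := normr_ge0 (ln M); lra.
have := normr_ge0 (ln (Num.min (E a A) (E a B))).
by have := ler_norm (ln M); lra.
Qed.

Lemma ev_affine (Q : borel_prob R) (k l : R) : probs_on A B Q ->
  ev A B Q (fun x => k + l * x) = k + l * ev A B Q id.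
Proof.
move=> Q1; rewrite evD//; [|exact: regular_cst|].
  by rewrite ev_cst// evZ//; exact: regular_id.
by apply: regularM; [exact: regular_cst|exact: regular_id].
Qed.

Lemma expect_E (P : borel_prob R) (a : R) : probs_on A B P ->
  expect A B P (fun x => (E a x)%:E) = (1 + a * (ev A B P id - mu0))%:E.
Proof.
move=> P1; rewrite expectE//; last exact: regular_E.
have -> : E a = (fun x => (1 - a * mu0) + a * x).
  by apply/funext => x; rewrite /E_; ring.
by rewrite ev_affine//; congr (_%:E); ring.
Qed.

Lemma evars_E (N : set (borel_prob R)) (a : R) :
  I_ A B mu0 a -> N `<=` probs_on A B ->
  (forall P, N P -> a * (ev A B P id - mu0) <= 0) ->
  evars A B N (E a).
Proof.
move=> /I_E[EA EB] NP aN; split.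
- by case: (regular_E a).
- by move=> x; exact: E_ge0.
- move=> P NPP; rewrite expect_E; last exact: NP.
  by rewrite lee_fin; have := aN _ NPP; lra.
Qed.

Lemma evars_mean_eq_E (a : R) :
  I_ A B mu0 a -> evars A B (mean_eq A B mu0) (E a).
Proof.
move=> Ia; apply: evars_E => // [P []//|P [P1] /=].
by rewrite meanE// => -[->]; rewrite subrr mulr0.
Qed.

Lemma evars_mean_le_E (a : R) :
  I_ A B mu0 a -> 0 <= a -> evars A B (mean_le A B mu0) (E a).
Proof.
move=> Ia a0; apply: evars_E => // [P []//|P [P1] /=].
by rewrite meanE// lee_fin => m; rewrite mulr_ge0_le0// subr_le0.
Qed.

Lemma evars_sub (N N' : set (borel_prob R)) :
  N `<=` N' -> evars A B N' `<=` evars A B N.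
Proof. by move=> NN' e [me e0 eN]; split=> // P /NN'; exact: eN. Qed.

Lemma mean_eq_le : mean_eq A B mu0 `<=` mean_le A B mu0.
Proof. by move=> P [P1 /= m]; split=> //=; rewrite m. Qed.

(** The law on {x, y} with mean [mu0] belongs to the null; this is its constraint on [e], cleared of
    the denominator [y - x]. *)
Lemma twopt_evar (e : R -> R) (x y : R) :
  evars A B (mean_eq A B mu0) e -> A <= x < mu0 -> mu0 < y <= B ->
  (y - mu0) * e x + (mu0 - x) * e y <= y - x.
Proof.
move=> [me e0 eN] /andP[Ax xmu] /andP[muy yB].
have [Amu muB] := andP mu0AB.
have xAB : A <= x <= B by lra.
have yAB : A <= y <= B by lra.
have yx : 0 < y - x by lra.
pose t := (mu0 - x) / (y - x).
have t01 : 0 <= t <= 1.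
  by rewrite /t divr_ge0 ?ler_pdivrMr//; lra.
have := eN (twopt t x y); rewrite expect_twopt_real// lee_fin => H.
have {H} : (1 - t) * e x + t * e y <= 1.
  apply: H; split; first exact: twopt_probs_on.
  by rewrite /= mean_twopt//; congr (_%:E); rewrite /t; field; lra.
rewrite -(ler_pM2r yx) mul1r; congr (_ <= _).
by rewrite /t; field; rewrite gt_eqF//.
Qed.

(* The slope of the affine majorant is the largest slope of a chord of [e] from
   (mu0, 1) to a point on the right of mu0. *)
Lemma evar_dominated (e : R -> R) : evars A B (mean_eq A B mu0) e ->
  exists2 a, I_ A B mu0 a & forall x, A <= x <= B -> e x <= E a x.
Proof.
move=> ee; have [me e0 eN] := ee; have [Amu muB] := andP mu0AB.
pose S := [set (e y - 1) / (y - mu0) | y in [set y | mu0 < y <= B]].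
(* [twopt_evar] read as a comparison of slopes: chords from (mu0, 1) to the right are no steeper
   than chords to the left. *)
have Sub x : A <= x < mu0 -> ubound S ((1 - e x) / (mu0 - x)).
  move=> xA _ [y /= yB <-]; have := twopt_evar ee xA yB.
  rewrite ler_pdivrMr ?subr_gt0; last by case/andP: yB.
  rewrite mulrAC ler_pdivlMr ?subr_gt0; last by case/andP: xA.
  by lra.
have AA : A <= A < mu0 by lra.
have SB : S ((e B - 1) / (B - mu0)) by exists B => //=; lra.
have hS : has_sup S.
  by split; [exists ((e B - 1) / (B - mu0))|eexists; exact: Sub AA].
have Sle y : mu0 < y <= B -> e y <= E (sup S) y.
  move=> yB; have y0 : 0 < y - mu0 by lra.
  have : (e y - 1) / (y - mu0) <= sup S.
    by apply: sup_upper_bound => //; exists y.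
  by rewrite ler_pdivrMr// /E_; lra.
have Sge x : A <= x < mu0 -> e x <= E (sup S) x.
  move=> xA; have x0 : 0 < mu0 - x by lra.
  have : sup S <= (1 - e x) / (mu0 - x).
    by apply: ge_sup; [exists ((e B - 1) / (B - mu0))|exact: Sub].
  by rewrite ler_pdivlMr// /E_; lra.
exists (sup S).
  apply/I_E; split.
  (* The majorant is nonnegative at the ends because [e] is, which places its slope in [I_]. *)
  - by apply: le_trans (Sge A _) => //; apply: e0; lra.
  - by apply: le_trans (Sle B _); [apply: e0; lra|lra].
move=> x /andP[Ax xB]; have [xmu|mux|->] := ltgtP x mu0.
- by apply: Sge; lra.
- by apply: Sle; lra.
(* The Dirac mass at [mu0] is in the null and gives [e mu0 <= 1]. *)
- have muAB : A <= mu0 <= B by lra.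
  have t01 : 0 <= (0 : R) <= 1 by lra.
  have := eN (twopt 0 mu0 mu0); rewrite expect_twopt_real// lee_fin.
  rewrite /E_ subrr mulr0 addr0 subr0 mul1r mul0r addr0; apply.
  split; first exact: twopt_probs_on.
  by rewrite /= mean_twopt//; congr (_%:E); ring.
Qed.

(** Any single rival [E b] bounds the supremum [GRO] from below, which is the direction needed to
    bound a regret from above. *)
Lemma GRO_twopt_ge (N : set (borel_prob R)) (b t x y : R) :
  A <= x <= B -> A <= y <= B -> 0 <= t <= 1 ->
  evars A B N (E b) -> 0 < E b x -> 0 < E b y ->
  (((1 - t) * ln (E b x) + t * ln (E b y))%:E <= GRO A B N (twopt t x y))%E.
Proof.
move=> xAB yAB t01 eb bx by_.
apply: (@le_trans _ _ (epower A B (twopt t x y) (E b))).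
  apply: expect_twopt_ge => //; rewrite ?lne_EFin//.
  by apply: measurable_lne => //; case: eb.
by apply: ereal_sup_ubound; exists (E b).
Qed.

Lemma epower_E (Q : borel_prob R) (a : R) : probs_on A B Q ->
  0 < E a A -> 0 < E a B ->
  epower A B Q (E a) = (ev A B Q (fun x => ln (E a x)))%:E.
Proof.
move=> Q1 EA EB; rewrite -expectE//; last exact: regular_ln_E.
by apply: eq_integral => x /set_mem /mem_itvP xAB; rewrite lne_EFin// E_gt0.
Qed.

Lemma E_alpha0 : E 0 = fun=> 1.
Proof. by apply/funext => x; rewrite /E_ mul0r addr0. Qed.

(* Nonnegativity of GRO, witnessed by the e-variable 1, makes it a real number
   that can be moved out of the expectation. *)
Lemma regret_ge (N : set (borel_prob R)) (Q : borel_prob R) (a V : R) :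
  probs_on A B Q -> 0 < E a A -> 0 < E a B -> evars A B N (E 0) ->
  (forall e, evars A B N e ->
    (epower A B Q e <= (ev A B Q (fun x => ln (E a x)) - V)%:E)%E) ->
  (V%:E <= expect A B Q (fun x => lne (E a x)%:E - GRO A B N Q))%E.
Proof.
move=> Q1 EA EB e1 eV.
have G0 : (0 <= GRO A B N Q)%E.
  apply: (@le_trans _ _ (epower A B Q (E 0))); last first.
    by apply: ereal_sup_ubound; exists (E 0).
  by rewrite epower_E// E_alpha0// ln1 ev_cst.
have GV : (GRO A B N Q <= (ev A B Q (fun x => ln (E a x)) - V)%:E)%E.
  by apply: ge_ereal_sup => _ [e ee <-]; exact: eV.
have Gf : GRO A B N Q \is a fin_num.
  by rewrite ge0_fin_numE// (le_lt_trans GV)// ltry.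
move: G0 GV; rewrite -(fineK Gf); move: (fine _) => {Gf} g G0 GV.
have -> : expect A B Q (fun x => (lne (E a x)%:E - g%:E)%E)
        = expect A B Q (fun x => (ln (E a x) + (- g))%:E).
  apply: eq_integral => x /set_mem /mem_itvP xAB.
  by rewrite (lne_EFin (E_gt0 EA EB xAB)) -EFinB.
have rl := regular_ln_E EA EB.
rewrite expectE//; last by apply: regularD => //; exact: regular_cst.
rewrite evD//; last exact: regular_cst.
by rewrite ev_cst//; move: GV; rewrite !lee_fin; lra.
Qed.

(* [c] is the amount subtracted from the log-growth: 0 for GROW, GRO for
   REGROW. *)
Lemma maximin (N Q0 : set (borel_prob R)) (c : borel_prob R -> \bar R)
    (a0 V : R) :
  mean_eq A B mu0 `<=` N -> evars A B N (E a0) ->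
  (forall Q, Q0 Q ->
    (V%:E <= expect A B Q (fun x => lne (E a0 x)%:E - c Q))%E) ->
  (forall a eps : R, I_ A B mu0 a -> 0 < eps -> exists t x y u v g : R,
    [/\ [/\ A <= x <= B, A <= y <= B & 0 <= t <= 1],
        Q0 (twopt t x y), (g%:E <= c (twopt t x y))%E,
        E a x <= expR u /\ E a y <= expR v &
        (1 - t) * u + t * v - g <= V + eps]) ->
  ereal_inf [set expect A B Q (fun x => lne (E a0 x)%:E - c Q)%E | Q in Q0]
  = ereal_sup [set ereal_inf
      [set expect A B Q (fun x => lne (e x)%:E - c Q)%E | Q in Q0]
      | e in evars A B N].
Proof.
move=> NN ea0 lo up; apply/eqP; rewrite eq_le; apply/andP; split.
  by apply: ereal_sup_ubound; exists (E a0).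
apply: (@le_trans _ _ V%:E); last first.
  by apply: le_ereal_inf_tmp => _ [Q QQ <-]; exact: lo.
apply: ge_ereal_sup => _ [e ee <-].
(* An adversary that punishes the affine majorant [E a] punishes [e] at least as much. *)
have [a Ia ea] := evar_dominated (evars_sub NN ee).
(* The slack [eps] serves alternatives with a strict inequality on the mean, where the worst law is
   only approached. *)
apply/lee_addgt0Pr => eps eps0.
have [t [x [y [u [v [g H]]]]]] := up a eps Ia eps0.
have [[xAB yAB t01] Qt gc [xu yv] le_V] := H.
apply: (@le_trans _ _ (expect A B (twopt t x y)
    (fun z => lne (e z)%:E - c (twopt t x y))%E)).
  by apply: ereal_inf_lbound; exists (twopt t x y).
have [me e0 _] := ee.
have lnle z w : A <= z <= B -> E a z <= expR w ->
    (lne (e z)%:E - c (twopt t x y) <= (w - g)%:E)%E.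
  move=> zAB zw; rewrite EFinB; apply: leeB => //.
  rewrite /lne; case: ifPn; rewrite ?leNye// -ltNge => ez0.
  rewrite lee_fin -(expRK w) ler_ln ?posrE ?expR_gt0//.
  exact: le_trans (ea _ zAB) zw.
apply: (@le_trans _ _ ((1 - t) * (u - g) + t * (v - g))%:E).
  apply: expect_twopt_le => //; [|exact: lnle..].
  by apply: emeasurable_funB => //; exact: measurable_lne.
by rewrite -EFinD lee_fin; apply: le_trans le_V; lra.
Qed.

End EVariables.

(** * Tangent bounds for exp and ln *)

Lemma expR_tangent (R : realType) (u v : R) :
  0 < u -> v <= expR (ln u + (v / u - 1)).
Proof.
move=> u0; rewrite expRD lnK ?posrE//.
(* This is 1 + z <= exp z at z = v / u - 1. The exponential form covers [v = 0], the value at an end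
   of [A, B] of an [E a] with extreme slope. *)
have := expR_ge1Dx (v / u - 1); rewrite addrC subrK => H.
by apply: le_trans (ler_wpM2l (ltW u0) H); rewrite mulrC divfK ?gt_eqF.
Qed.

Lemma ln_tangent (R : realType) (u v : R) :
  0 < u -> 0 < v -> ln v <= ln u + (v / u - 1).
Proof.
move=> u0 v0; rewrite -[leRHS]expRK ler_ln ?posrE ?expR_gt0//.
exact: expR_tangent.
Qed.

(** * Log-growth under laws on {A, B}, and comparison of two affine e-variables *)

Section Growth.
Variables (R : realType) (A B mu0 mu1 : R).
Notation E := (E_ mu0).
Notation aGW := (alpha_GW A B mu0 mu1).
Notation amax := (alpha_max A mu0).
Notation p := ((mu1 - A) / (B - A)).

(** The expected log of [E a] under [twopt t A B], when both end values are positive. *)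
Definition growth (t a : R) : R := (1 - t) * ln (E a A) + t * ln (E a B).

(** The derivative of [growth t] at [a]. *)
Definition growth_slope (t a : R) : R :=
  (1 - t) * ((A - mu0) / E a A) + t * ((B - mu0) / E a B).

Lemma growth0 (t : R) : growth t 0 = 0.
Proof. by rewrite /growth E_alpha0 ln1; ring. Qed.

(** The left side averages the exponents offered by [expR_tangent] at the two ends; the right side
    is the tangent at [a] of the concave function [growth t]. *)
Lemma growth_tangentE (t a a' : R) : 0 < E a A -> 0 < E a B ->
  (1 - t) * (ln (E a A) + (E a' A / E a A - 1))
  + t * (ln (E a B) + (E a' B / E a B - 1))
  = growth t a + (a' - a) * growth_slope t a.
Proof.
move=> EA EB; rewrite /growth /growth_slope; move: EA EB; rewrite /E_ => EA EB.
by field; rewrite !gt_eqF.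
Qed.

Lemma growth_le_tangent (t a a' : R) : 0 <= t <= 1 ->
  0 < E a A -> 0 < E a B -> 0 < E a' A -> 0 < E a' B ->
  growth t a' <= growth t a + (a' - a) * growth_slope t a.
Proof.
move=> /andP[t0 t1] EA EB EA' EB'; rewrite -growth_tangentE// /growth.
by rewrite lerD// ler_wpM2l ?subr_ge0// ln_tangent.
Qed.

Hypothesis mu0AB : A < mu0 < B.
Hypothesis mu1AB : A < mu1 < B.

(** At the weight [p], for which the law on {A, B} has mean [mu1], the derivative has the sign of
    [aGW - a], so [aGW] is the maximiser. *)
Lemma growth_slopeE (a : R) : 0 < E a A -> 0 < E a B ->
  growth_slope p a
  = (mu0 - A) * (B - mu0) * (aGW - a) / (E a A * E a B).
Proof.
have [Amu muB] := andP mu0AB.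
rewrite /growth_slope /alpha_GW /E_ => EA EB; field.
by rewrite !gt_eqF//; lra.
Qed.

Lemma weight01 : 0 < p < 1.
Proof.
have [Amu muB] := andP mu1AB.
by rewrite divr_gt0 ?ltr_pdivrMr//; lra.
Qed.

Lemma weight01W : 0 <= p <= 1.
Proof. by have /andP[/ltW-> /ltW->] := weight01. Qed.

Lemma growth_tangent_le (a a' : R) : aGW <= a -> a <= a' ->
  0 < E a A -> 0 < E a B ->
  growth p a + (a' - a) * growth_slope p a <= growth p a.
Proof.
move=> Ga aa' EA EB; have [Amu muB] := andP mu0AB.
rewrite gerDl mulr_ge0_le0 ?subr_ge0// growth_slopeE//.
rewrite mulr_le0_ge0 ?invr_ge0 ?mulr_ge0 ?(ltW EA) ?(ltW EB)//.
by rewrite mulr_ge0_le0 ?mulr_ge0//; lra.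
Qed.

Lemma growth_decreasing (a a' : R) : aGW <= a -> a <= a' ->
  0 < E a A -> 0 < E a B -> 0 < E a' A -> 0 < E a' B ->
  growth p a' <= growth p a.
Proof.
move=> Ga aa' EA EB EA' EB'.
apply: le_trans (growth_le_tangent weight01W EA EB EA' EB') _.
exact: growth_tangent_le.
Qed.

Lemma E_aGW_gt0 : mu0 < mu1 -> 0 < E aGW A /\ 0 < E aGW B.
Proof.
move=> mu01; have [Amu muB] := andP mu0AB; have [Amu' muB'] := andP mu1AB.
have -> : E aGW A = (B - mu1) / (B - mu0).
  by rewrite /E_ /alpha_GW; field; rewrite !gt_eqF//; lra.
have -> : E aGW B = (mu1 - A) / (mu0 - A).
  by rewrite /E_ /alpha_GW; field; rewrite !gt_eqF//; lra.
by rewrite !divr_gt0//; lra.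
Qed.

Lemma aGW_gt0 : mu0 < mu1 -> 0 < aGW.
Proof.
by move=> mu01; have [Amu muB] := andP mu0AB; rewrite divr_gt0 ?mulr_gt0//; lra.
Qed.

Lemma growth_le_aGW (a : R) : mu0 < mu1 -> 0 < E a A -> 0 < E a B ->
  growth p a <= growth p aGW.
Proof.
move=> mu01 EA EB; have [GA GB] := E_aGW_gt0 mu01.
have := growth_le_tangent weight01W GA GB EA EB.
by rewrite growth_slopeE// subrr mulr0 mul0r mulr0 addr0.
Qed.

Lemma E_A_le (a a' : R) : a <= a' -> E a' A <= E a A.
Proof. by move=> aa'; have [Amu muB] := andP mu0AB; rewrite /E_; nra. Qed.

Lemma E_le (a a' x : R) : mu0 <= x -> a <= a' -> E a x <= E a' x.
Proof. by move=> mux aa'; rewrite /E_; nra. Qed.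

Lemma E_ge1 (a x : R) : mu0 <= x -> 0 <= a -> 1 <= E a x.
Proof. by move=> mux aa'; rewrite /E_; nra. Qed.

(* The ratio E_a / E_b is a concave function when 0 <= b <= a, hence so is its
   logarithm, which therefore lies above its chord over [A, B]. *)
Lemma ln_ratio_concave (a b x t : R) : 0 <= b -> b <= a -> 0 < E a A ->
  A <= x <= B -> t = (x - A) / (B - A) ->
  growth t a - growth t b + ln (E b x) <= ln (E a x).
Proof.
move=> b0 ba EaA /andP[Ax xB] tE; have [Amu muB] := andP mu0AB.
have AB : 0 < B - A by lra.
have t0 : 0 <= t by rewrite tE divr_ge0//; lra.
have t1 : 0 <= 1 - t by rewrite tE subr_ge0 ler_pdivrMr//; lra.
have uA : E a A <= E b A := E_A_le ba.
have vB : E b B <= E a B by apply: E_le => //; lra.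
have uv : E b A <= E b B by rewrite /E_; nra.
have xab c : E c x = (1 - t) * E c A + t * E c B.
  by rewrite tE /E_; field; rewrite gt_eqF.
have u0 : 0 < E b A by lra.
have v0 : 0 < E b B by lra.
have y0 : 0 < E a B by lra.
have w0 : 0 < E b x by rewrite xab; nra.
have z0 : 0 < E a x by rewrite xab; nra.
(* Jensen's inequality for [ln], through its tangent at the value of the ratio at [x]. *)
have lnA := ln_tangent (divr_gt0 z0 w0) (divr_gt0 EaA u0).
have lnB := ln_tangent (divr_gt0 z0 w0) (divr_gt0 y0 v0).
have rat : (1 - t) * (E a A / E b A / (E a x / E b x))
         + t * (E a B / E b B / (E a x / E b x)) <= 1.
  have -> : (1 - t) * (E a A / E b A / (E a x / E b x))
         + t * (E a B / E b B / (E a x / E b x))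
      = ((1 - t) * (E a A / E b A) + t * (E a B / E b B)) * E b x / E a x.
    by field; rewrite !gt_eqF.
  rewrite ler_pdivrMr// mul1r -subr_ge0 !xab.
  (* The concavity defect factors: [E b] is nondecreasing, and the ratio is at most 1 at [A] and at
     least 1 at [B]. *)
  have -> : (1 - t) * E a A + t * E a B
    - ((1 - t) * (E a A / E b A) + t * (E a B / E b B))
       * ((1 - t) * E b A + t * E b B)
    = (1 - t) * t * (E b B - E b A) * (E a B / E b B - E a A / E b A).
    by field; rewrite !gt_eqF.
  apply: mulr_ge0; first by rewrite !mulr_ge0// subr_ge0.
  have h1 : 1 <= E a B / E b B by rewrite ler_pdivlMr// mul1r.
  have h2 : E a A / E b A <= 1 by rewrite ler_pdivrMr// mul1r.
  by rewrite subr_ge0 (le_trans h2).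
move: lnA lnB; rewrite !ln_div ?posrE// => lnA lnB.
have := ler_wpM2l t1 lnA; have := ler_wpM2l t0 lnB.
rewrite /growth; move: rat; lra.
Qed.

(** The chord of the log ratio over [A, B] takes at [mu1] the value weighted by [p], a difference of
    growths. Its slope [c] is nonnegative, so a mean above [mu1] can only raise the bound. *)
Lemma ln_ratio_ge_affine (a b : R) : 0 <= b -> b <= a -> 0 < E a A ->
  exists2 c, 0 <= c & forall x, A <= x <= B ->
  growth p a - growth p b + c * (x - mu1) + ln (E b x) <= ln (E a x).
Proof.
move=> b0 ba EaA; have [Amu muB] := andP mu0AB.
have uA : E a A <= E b A := E_A_le ba.
have vB : E b B <= E a B by apply: E_le => //; lra.
have uv : E b A <= E b B by rewrite /E_; nra.
have u0 : 0 < E b A by lra.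
have v0 : 0 < E b B by lra.
have y0 : 0 < E a B by lra.
exists (((ln (E a B) - ln (E b B)) - (ln (E a A) - ln (E b A))) / (B - A)).
  have : ln (E a A) <= ln (E b A) by rewrite ler_ln.
  have : ln (E b B) <= ln (E a B) by rewrite ler_ln.
  by move=> ? ?; rewrite divr_ge0//; lra.
move=> x xAB; apply: le_trans (ln_ratio_concave b0 ba EaA xAB erefl).
rewrite lerD2r le_eqVlt; apply/orP; left; apply/eqP.
by rewrite /growth; field; rewrite gt_eqF//; lra.
Qed.

(** For [0 <= b] this is the chord bound together with the maximality of [aGW] for [growth p];
    negative slopes are reduced to slope 0. *)
Lemma E_le_below (a b : R) : mu0 < mu1 -> 0 <= a -> 0 < E a A -> b <= a ->
  I_ A B mu0 b ->
  exists2 c, 0 <= c & forall x, A <= x <= B ->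
  E b x <= expR (ln (E a x) - (growth p a - growth p aGW) - c * (x - mu1)).
Proof.
move=> mu01 a0 EaA ba Ib; have [Amu muB] := andP mu0AB.
have below (b' : R) : 0 <= b' -> b' <= a ->
    exists2 c, 0 <= c & forall x, A <= x <= B ->
    E b' x <= expR (ln (E a x) - (growth p a - growth p aGW) - c * (x - mu1)).
  move=> b'0 b'a; have [c c0 Hc] := ln_ratio_ge_affine b'0 b'a EaA.
  have EA : 0 < E b' A by rewrite (lt_le_trans EaA)// E_A_le.
  have EB : 0 < E b' B by rewrite (lt_le_trans ltr01)// E_ge1// ltW.
  exists c => // x xAB; have Ex := E_gt0 EA EB xAB.
  rewrite -[leLHS]lnK ?posrE// ler_expR.
  by have := growth_le_aGW mu01 EA EB; have := Hc _ xAB; lra.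
have [b0|b0] := leP 0 b; first exact: below.
have [c c0 Hc] := below 0 (lexx 0) a0.
(* From 1 + z <= exp z, [E b x] is at most exp (b (x - mu0)). Recentring at [mu1] adds b (mu1 - mu0)
   <= 0, and the rest of the exponent goes into [c]. *)
exists (c - b); first lra.
move=> x xAB; apply: (@le_trans _ _ (expR (b * (x - mu0)))).
  exact: expR_ge1Dx.
have := Hc _ xAB; rewrite E_alpha0 -expR0 !ler_expR => H.
have : 0 <= - b * (mu1 - mu0) by rewrite mulr_ge0//; lra.
lra.
Qed.

(* The ratio E_b / E_a is concave and is bounded by its tangent at mu1. *)
Lemma E_le_above_tangent (a b : R) : mu0 < mu1 -> 0 <= a -> 0 < E a A ->
  a <= b -> I_ A B mu0 b ->
  exists c, forall x, A <= x <= B ->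
  E b x <= expR (ln (E a x) - (ln (E a mu1) - ln (E amax mu1))
                 - c * (x - mu1)).
Proof.
move=> mu01 a0 EaA ab Ib; have [Amu muB] := andP mu0AB.
have bmax : b <= amax by move: Ib; rewrite /I_ /= in_itv => /andP[].
have EaB : 0 < E a B by rewrite (lt_le_trans ltr01)// E_ge1// ltW.
have mu1_in_itv : A <= mu1 <= B by case/andP: mu1AB => /ltW-> /ltW->.
have Ea1 : 0 < E a mu1 := E_gt0 EaA EaB mu1_in_itv.
have Eb1 : 0 < E b mu1 by rewrite (lt_le_trans Ea1)// E_le// ltW.
have Em1 : 0 < E amax mu1 by rewrite (lt_le_trans Eb1)// E_le// ltW.
(* Up to sign, the derivative at [mu1] of ln (E_b / E_a), since b E_a - a E_b = b - a. *)
exists (- ((b - a) / (E a mu1 * E b mu1))) => x xAB.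
have Ex := E_gt0 EaA EaB xAB.
have -> : ln (E a x) - (ln (E a mu1) - ln (E amax mu1))
    - - ((b - a) / (E a mu1 * E b mu1)) * (x - mu1)
  = ln (E a x * (E amax mu1 / E a mu1))
    + (b - a) / (E a mu1 * E b mu1) * (x - mu1).
  by rewrite lnM ?ln_div ?posrE ?divr_gt0//; ring.
have m0 : 0 < E amax mu1 / E a mu1 by rewrite divr_gt0.
rewrite expRD lnK; last by rewrite posrE mulr_gt0.
set k := (b - a) / _.
have k0 : 0 <= k by rewrite divr_ge0 ?subr_ge0// mulr_ge0// ltW.
apply: (@le_trans _ _ (E a x * (E b mu1 / E a mu1) * (1 + k * (x - mu1)))).
  rewrite -subr_ge0.
  (* Multiplied by [E a x], the gap between tangent and ratio is a nonnegative multiple of (x -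
     mu1)^2. *)
  have -> : E a x * (E b mu1 / E a mu1) * (1 + k * (x - mu1)) - E b x
    = (b - a) * a * (x - mu1) ^+ 2 / E a mu1 ^+ 2.
    rewrite /k; move: Ea1 Eb1; rewrite /E_ => Ea1 Eb1.
    by field; rewrite !gt_eqF.
  by rewrite divr_ge0 ?sqr_ge0// mulr_ge0 ?sqr_ge0// mulr_ge0// subr_ge0.
have q0 : 0 < E b mu1 / E a mu1 by rewrite divr_gt0.
have q1 : E b mu1 / E a mu1 <= E amax mu1 / E a mu1.
  by rewrite ler_pM2r ?invr_gt0// E_le// ltW.
apply: (@le_trans _ _ (E a x * (E b mu1 / E a mu1) * expR (k * (x - mu1)))).
  by rewrite ler_wpM2l ?expR_ge1Dx// mulr_ge0// ltW.
by rewrite ler_wpM2r ?expR_ge0// ler_wpM2l// ltW.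
Qed.

(** For [a <= b] the ratio E_b / E_a increases in [x], so it is largest at [B], where [E amax] in
    turn dominates [E b]. *)
Lemma E_le_above (a b : R) : 0 <= a -> 0 < E a A -> a <= b -> I_ A B mu0 b ->
  forall x, A <= x <= B ->
  E b x <= expR (ln (E a x) - (ln (E a B) - ln (E amax B))).
Proof.
move=> a0 EaA ab Ib x xAB; have [Amu muB] := andP mu0AB.
have bmax : b <= amax by move: Ib; rewrite /I_ /= in_itv => /andP[].
have EaB : 0 < E a B by rewrite (lt_le_trans ltr01)// E_ge1// ltW.
have EmB : 0 < E amax B.
  by rewrite (lt_le_trans ltr01)// E_ge1 ?ltW// /alpha_max invr_gt0 subr_gt0.
have Ex := E_gt0 EaA EaB xAB.
rewrite opprB addrA -lnM ?posrE// -ln_div ?posrE ?mulr_gt0//.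
rewrite lnK ?posrE ?divr_gt0 ?mulr_gt0// ler_pdivlMr//.
apply: (@le_trans _ _ (E a x * E b B)).
  rewrite -subr_ge0.
  have -> : E a x * E b B - E b x * E a B = (b - a) * (B - x).
    by rewrite /E_; ring.
  by rewrite mulr_ge0//; lra.
by apply: ler_wpM2l; [exact: ltW|rewrite E_le// ltW].
Qed.

(** Integrates a pointwise domination. The linear term contributes [c] times the excess of the mean
    over [mu1]: any [c] will do when the mean is [mu1], and [0 <= c] when it is larger. *)
Lemma epower_le_shift (Q : borel_prob R) (a V c : R) (e : R -> R) :
  probs_on A B Q -> 0 < E a A -> 0 < E a B -> measurable_fun [set` `[A, B]] e ->
  0 <= c * (ev A B Q id - mu1) ->
  (forall x, A <= x <= B -> e x <= expR (ln (E a x) - V - c * (x - mu1))) ->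
  (epower A B Q e <= (ev A B Q (fun x => ln (E a x)) - V)%:E)%E.
Proof.
move=> Q1 EA EB me cm ec.
have rl := regular_ln_E EA EB.
have raff (k l : R) : regular A B (fun x => k + l * x).
  apply: regularD; first exact: regular_cst.
  by apply: regularM; [exact: regular_cst|exact: regular_id].
apply: le_trans (epower_le Q1 me
    (g := fun x => ln (E a x) + ((c * mu1 - V) + - c * x)) _ _) _.
- exact: regularD.
- by move=> x xAB; apply: le_trans (ec x xAB) _; rewrite ler_expR; lra.
- rewrite evD// ev_affine// lee_fin; lra.
Qed.

End Growth.

(** * The equations that determine the REGROW slopes *)

Section Solutions.
Variables (R : realType) (A B mu0 mu1 : R).
Hypotheses (mu0AB : A < mu0 < B) (mu1AB : A < mu1 < B) (mu01 : mu0 < mu1).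
Notation E := (E_ mu0).
Notation aGW := (alpha_GW A B mu0 mu1).
Notation amax := (alpha_max A mu0).
Notation p := ((mu1 - A) / (B - A)).
Notation growth := (growth A B mu0).

Lemma E_amax (x : R) : E amax x = (x - A) / (mu0 - A).
Proof.
have [Amu muB] := andP mu0AB.
by rewrite /E_ /alpha_max; field; rewrite gt_eqF//; lra.
Qed.

Lemma E_amax_gt0 (x : R) : A < x -> 0 < E amax x.
Proof.
by move=> Ax; have [Amu muB] := andP mu0AB; rewrite E_amax divr_gt0//; lra.
Qed.

Lemma amax_gt0 : 0 < amax.
Proof. by have [Amu muB] := andP mu0AB; rewrite invr_gt0; lra. Qed.

Lemma lt_amax (a : R) : (a < amax) = (0 < E a A).
Proof.
have [Amu muB] := andP mu0AB.
rewrite /alpha_max -div1r ltr_pdivlMr; last lra.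
by rewrite /E_; apply/idP/idP; lra.
Qed.

Lemma I_nonneg (a : R) : 0 <= a -> 0 <= E a A -> I_ A B mu0 a.
Proof.
move=> a0 EA; apply/(I_E mu0AB); split=> //.
by rewrite (le_trans ler01)// E_ge1//; case/andP: mu0AB => _ /ltW.
Qed.

Lemma I_amax : I_ A B mu0 amax.
Proof. by apply: I_nonneg; rewrite ?(ltW amax_gt0)// E_amax subrr mul0r. Qed.

Lemma aGW_lt_amax : 0 < aGW < amax.
Proof.
by rewrite lt_amax aGW_gt0//; case: (E_aGW_gt0 mu0AB mu1AB mu01).
Qed.

Lemma E_B_gt0 (a : R) : 0 <= a -> 0 < E a B.
Proof.
by move=> a0; rewrite (lt_le_trans ltr01)// E_ge1//; case/andP: mu0AB => _ /ltW.
Qed.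

(** Equal regrets for the Dirac mass at [mu1], with rival [E amax], and for the law on {A, B} with
    mean [mu1], with rival [E aGW]. *)
Definition equalizes (a : R) :=
  ln (E a mu1) - ln (E amax mu1) = growth p a - growth p aGW.

(** At [a = amax] the right side is -oo and the left side is real, so every solution has
    [0 < E a A]; there both sides are real. *)
Lemma equalizesE (a : R) : I_ A B mu0 a -> aGW < a ->
  F_ mu0 a amax mu1 = G_ A B mu0 a aGW mu1 <-> 0 < E a A /\ equalizes a.
Proof.
move=> Ia GWa; have [Amu muB] := andP mu0AB; have [Amu' muB'] := andP mu1AB.
have [GA GB] := E_aGW_gt0 mu0AB mu1AB mu01.
have [EA0 _] := (I_E mu0AB a).1 Ia.
have a0 : 0 < a by have /andP[] := aGW_lt_amax; lra.
have Em1 : 0 < E amax mu1 by exact: E_amax_gt0.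
have Ea1 : 0 < E a mu1 by rewrite (lt_le_trans ltr01)// E_ge1// ltW.
have EaB := E_B_gt0 (ltW a0).
have FE x : 0 < E a x -> 0 < E aGW x ->
    F_ mu0 a aGW x = (ln (E a x) - ln (E aGW x))%:E.
  by move=> Ex Gx; rewrite /F_ /quot gt_eqF// lne_EFin ?divr_gt0// ln_div.
have -> : F_ mu0 a amax mu1 = (ln (E a mu1) - ln (E amax mu1))%:E.
  by rewrite /F_ /quot gt_eqF// lne_EFin ?divr_gt0// ln_div.
rewrite /G_ (FE B)//.
have [EA|EA] := ltP 0 (E a A).
  rewrite FE// -!EFinM /equalizes.
  have -> : ((B - mu1) * (ln (E a A) - ln (E aGW A)) +
      (mu1 - A) * (ln (E a B) - ln (E aGW B))) / (B - A)
      = growth p a - growth p aGW.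
    by rewrite /growth; field; rewrite gt_eqF//; lra.
  by split=> [[]|[_ ->]].
have {EA EA0} EA : E a A = 0 by apply/eqP; rewrite eq_le EA EA0.
split=> [|[]//]; rewrite /F_ /quot gt_eqF// EA mul0r /= lexx.
rewrite gt0_muleNy ?lte_fin ?subr_gt0// -EFinM addNye.
by rewrite gt0_mulNye// lte_fin invr_gt0; lra.
Qed.

(** Beyond [aGW] the left side of the equation strictly increases in the slope, while the right side
    does not increase. *)
Lemma equalizes_unique (a a' : R) : aGW < a -> aGW < a' ->
  0 < E a A -> 0 < E a' A -> equalizes a -> equalizes a' -> a = a'.
Proof.
have /andP[G0 _] := aGW_lt_amax.
wlog aa' : a a' / a < a' => [H|] Ga Ga' EA EA' ea ea'.
  have [lt|lt|//] := ltgtP a a'; first exact: (H a a').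
  by apply/esym; exact: (H a' a).
have Em c : aGW < c -> 0 < E c mu1.
  by move=> Gc; rewrite (lt_le_trans ltr01)// E_ge1 ?ltW// (lt_trans G0).
have E1 : ln (E a mu1) < ln (E a' mu1).
  by rewrite ltr_ln ?posrE ?Em// /E_ ltrD2l ltr_pM2r ?subr_gt0.
have dec := growth_decreasing mu0AB mu1AB (ltW Ga) (ltW aa') EA
  (E_B_gt0 (ltW (lt_trans G0 Ga))) EA' (E_B_gt0 (ltW (lt_trans G0 Ga'))).
by move: ea ea'; rewrite /equalizes; lra.
Qed.

Lemma continuous_ln_E (x a : R) : 0 < E a x ->
  {for a, continuous (fun a => ln (E a x))}.
Proof.
move=> Ex; apply: continuous_comp; last exact: continuous_ln.
apply: cvgD; first exact: cvg_cst.
by apply: cvgM; [exact: cvg_id|exact: cvg_cst].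
Qed.

(** Intermediate values: left minus right is negative at [aGW] and nonnegative near [amax], where
    the log at [A] tends to -oo. *)
Lemma equalizes_exists : exists a, [/\ aGW < a, 0 < E a A & equalizes a].
Proof.
have [Amu muB] := andP mu0AB; have [Amu' muB'] := andP mu1AB.
have /andP[G0 Gm] := aGW_lt_amax.
have [GA GB] := E_aGW_gt0 mu0AB mu1AB mu01.
have /andP[p0 p1] := weight01 mu1AB.
pose phi a := ln (E a mu1) - ln (E amax mu1) - (growth p a - growth p aGW).
(* [K] is solved from a lower bound for [phi], so that ln (E a1 A) <= K forces [0 <= phi a1]. The
   minimum in [d] also gives [aGW <= a1], and [a1] is the slope with [E a1 A = d]. *)
pose K := (ln (E aGW mu1) - ln (E amax mu1) - p * ln (E amax B)
  + growth p aGW) / (1 - p).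
pose d := Num.min (expR K) (E aGW A).
have d0 : 0 < d by rewrite lt_min expR_gt0.
have dK : ln d <= K by rewrite -(expRK K) ler_ln ?posrE ?expR_gt0// ge_min lexx.
pose a1 := (1 - d) / (mu0 - A).
have E1A : E a1 A = d by rewrite /E_ /a1; field; rewrite gt_eqF//; lra.
have Ga1 : aGW <= a1.
  rewrite /a1 ler_pdivlMr; last lra.
  have : d <= E aGW A by rewrite ge_min lexx orbT.
  by rewrite /E_; lra.
have a1m : a1 < amax by rewrite lt_amax E1A.
have E1 a : aGW <= a -> 0 < E a mu1.
  by move=> Ga; rewrite (lt_le_trans ltr01)// E_ge1 ?ltW// (lt_le_trans G0).
have EB a : aGW <= a -> 0 < E a B.
  by move=> Ga; rewrite E_B_gt0// (le_trans (ltW G0)).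
have EA a : a <= a1 -> 0 < E a A.
  by move=> aa1; rewrite -lt_amax (le_lt_trans aa1).
have phi0 : phi aGW < 0.
  have : ln (E aGW mu1) < ln (E amax mu1).
    have h1 := E1 _ (lexx aGW); have h2 := E_amax_gt0 Amu'.
    by rewrite ltr_ln ?posrE// /E_ ltrD2l ltr_pM2r ?subr_gt0.
  by rewrite /phi subrr; lra.
have phi1 : 0 <= phi a1.
  have : ln (E aGW mu1) <= ln (E a1 mu1).
    by rewrite ler_ln ?posrE ?E1// E_le// ltW.
  have lB : ln (E a1 B) <= ln (E amax B).
    have h1 := EB _ Ga1; have h2 : 0 < E amax B by apply: E_amax_gt0; lra.
    by rewrite ler_ln ?posrE// E_le// ltW.
  have : p * ln (E a1 B) <= p * ln (E amax B) by rewrite ler_wpM2l// ltW.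
  have : (1 - p) * ln d <= (1 - p) * K by rewrite ler_wpM2l// subr_ge0 ltW.
  rewrite [X in _ <= X]mulrC divfK; last by rewrite gt_eqF// subr_gt0.
  by rewrite /phi {2}/growth E1A; lra.
have cphi : {within `[aGW, a1], continuous phi}.
  apply: continuous_in_subspaceT => a.
  rewrite inE /= in_itv /= => /andP[Ga aa1].
  have c1 := continuous_ln_E (E1 a Ga).
  have cA := continuous_ln_E (EA a aa1); have cB := continuous_ln_E (EB a Ga).
  by apply: cvgB; apply: cvgB => //; try exact: cvg_cst; apply: cvgD;
    (apply: cvgM; first exact: cvg_cst).
have [|a] := IVT Ga1 cphi (v := 0).
  by rewrite ge_min le_max (ltW phi0) phi1 orbT.
rewrite in_itv /= => /andP[Ga aa1] pa; exists a; split.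
- rewrite lt_neqAle Ga andbT; apply/eqP => aE.
  by move: phi0; rewrite aE pa ltxx.
- exact: EA.
- by apply/eqP; rewrite /equalizes -subr_eq0; apply/eqP.
Qed.

(** The equalizing equation with the Dirac mass moved to [B]. With s = (1 - p) r the left side is -
    ln (1 + s), which also occurs on the right; what remains is (1 - p) ln r = p ln p, the
    definition of [r]. *)
Lemma onesided_equalizes (a : R) : a = alpha_RGW_onesided A B mu0 mu1 ->
  [/\ aGW < a, 0 < E a A &
      ln (E a B) - ln (E amax B) = growth p a - growth p aGW].
Proof.
move=> aE.
have [Amu muB] := andP mu0AB; have [Amu' muB'] := andP mu1AB.
have /andP[p0 p1] := weight01 mu1AB.
set r := r_ A B mu1; set s := (B - mu1) / (B - A) * r.
have r0 : 0 < r by rewrite powR_gt0.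
have lnr : ln r = p / (1 - p) * ln p.
  rewrite /r /r_ ln_powR; congr (_ * _).
  by field; rewrite !gt_eqF//; lra.
have r1 : r < 1.
  rewrite -ltr_ln ?posrE// ln1 lnr nmulr_llt0 ?ln_lt0 ?p0//.
  by rewrite divr_gt0// subr_gt0.
have s0 : 0 < s by rewrite mulr_gt0// divr_gt0//; lra.
have EaA : E a A = s / (1 + s) * ((B - A) / (B - mu0)).
  rewrite /E_ aE /alpha_RGW_onesided -/r /s; field.
  by rewrite !gt_eqF//; nra.
have EaB : E a B = (B - A) / (mu0 - A) / (1 + s).
  rewrite /E_ aE /alpha_RGW_onesided -/r /s; field.
  by rewrite !gt_eqF//; nra.
have GA : E aGW A = (1 - p) * ((B - A) / (B - mu0)).
  by rewrite /E_ /alpha_GW; field; rewrite !gt_eqF//; lra.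
have GB : E aGW B = p * ((B - A) / (mu0 - A)).
  by rewrite /E_ /alpha_GW; field; rewrite !gt_eqF//; lra.
have k0 : 0 < (B - A) / (B - mu0) by rewrite divr_gt0//; lra.
have k1 : 0 < (B - A) / (mu0 - A) by rewrite divr_gt0//; lra.
have s1 : 0 < 1 + s by lra.
have sE : s = (1 - p) * r by rewrite /s; field; rewrite gt_eqF//; lra.
have p1' : 0 < 1 - p by rewrite subr_gt0.
split.
(* This comes down to p r < 1. *)
- have : E aGW B < E a B.
    rewrite GB EaB [p * _]mulrC ltr_pM2l// -[ltRHS]mul1r ltr_pdivlMr// sE.
    by nra.
  by rewrite /E_; nra.
- by rewrite EaA mulr_gt0// divr_gt0.
- have lnA : ln (E a A) = ln (1 - p) + p / (1 - p) * ln p - ln (1 + s)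
      + ln ((B - A) / (B - mu0)).
    have lns : ln s = ln (1 - p) + p / (1 - p) * ln p.
      by rewrite sE [ln (_ * r)]lnM ?posrE// lnr.
    rewrite EaA [ln (s / _ * _)]lnM ?posrE//; last by rewrite divr_gt0.
    by rewrite [ln (s / _)]ln_div ?posrE// lns.
  have lnB : ln (E a B) = ln ((B - A) / (mu0 - A)) - ln (1 + s).
    by rewrite EaB [ln (_ / (1 + s))]ln_div ?posrE.
  rewrite /growth lnA lnB GA GB E_amax [ln (p * _)]lnM ?posrE//.
  rewrite [ln ((1 - p) * _)]lnM ?posrE//.
  by move: (p) p1' => P P1; field; rewrite gt_eqF.
Qed.

End Solutions.

(** * Sufficient conditions for GROW and REGROW maximisers *)

Section Optimality.
Variables (R : realType) (A B mu0 : R).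
Hypothesis mu0AB : A < mu0 < B.
Notation E := (E_ mu0).
Notation amax := (alpha_max A mu0).

Lemma is_GROW_intro (N Q0 : set (borel_prob R)) (a0 V : R) :
  mean_eq A B mu0 `<=` N -> evars A B N (E a0) ->
  (forall Q, Q0 Q -> (V%:E <= epower A B Q (E a0))%E) ->
  (forall a eps : R, I_ A B mu0 a -> 0 < eps -> exists t x y u v : R,
    [/\ [/\ A <= x <= B, A <= y <= B & 0 <= t <= 1],
        Q0 (twopt t x y),
        E a x <= expR u /\ E a y <= expR v &
        (1 - t) * u + t * v <= V + eps]) ->
  is_GROW A B N Q0 (E a0).
Proof.
move=> NN ea0 lo up; split=> //.
have sub0 (e : R -> R) Q : epower A B Q e
    = expect A B Q (fun x => lne (e x)%:E - (fun=> 0) Q)%E.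
  by apply: eq_integral => x _; rewrite sube0.
have wE : worst_epower A B Q0 = fun e => ereal_inf
    [set expect A B Q (fun x => lne (e x)%:E - (fun=> 0) Q)%E | Q in Q0].
  apply/funext => e; congr ereal_inf; congr (_ @` _).
  by apply/funext => Q; exact: sub0.
rewrite /GROW wE.
apply: (maximin (V := V) mu0AB NN ea0) => [Q QQ|a eps Ia eps0].
- by rewrite -sub0; exact: lo.
- have [t [x [y [u [v [txy Qt uv le_V]]]]]] := up _ _ Ia eps0.
  by exists t, x, y, u, v, 0; split=> //; rewrite subr0.
Qed.

Lemma is_REGROW_intro (N Q0 : set (borel_prob R)) (a0 V : R) :
  mean_eq A B mu0 `<=` N -> Q0 `<=` probs_on A B ->
  evars A B N (E 0) -> evars A B N (E a0) ->
  0 < E a0 A -> 0 < E a0 B ->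
  (forall Q e, Q0 Q -> evars A B N e ->
    (epower A B Q e <= (ev A B Q (fun x => ln (E a0 x)) - V)%:E)%E) ->
  (forall a eps : R, I_ A B mu0 a -> 0 < eps -> exists t x y u v g : R,
    [/\ [/\ A <= x <= B, A <= y <= B & 0 <= t <= 1],
        Q0 (twopt t x y), (g%:E <= GRO A B N (twopt t x y))%E,
        E a x <= expR u /\ E a y <= expR v &
        (1 - t) * u + t * v - g <= V + eps]) ->
  is_REGROW A B N Q0 (E a0).
Proof.
move=> NN Q0P e1 ea0 EA EB lo up; split=> //.
apply: (maximin (V := V) mu0AB NN ea0) => // Q QQ.
by apply: regret_ge => // [|e ee]; [exact: Q0P|exact: lo].
Qed.

Lemma twopt_id_GRO (N : set (borel_prob R)) (b x : R) : A <= x <= B ->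
  evars A B N (E b) -> 0 < E b x ->
  ((ln (E b x))%:E <= GRO A B N (twopt 0 x x))%E.
Proof.
move=> xAB eb bx.
have t01 : 0 <= (0 : R) <= 1 by rewrite lexx ler01.
have := GRO_twopt_ge xAB xAB t01 eb bx bx.
by rewrite subr0 mul1r mul0r addr0.
Qed.

Lemma mean_twopt_id (x : R) : A <= x <= B -> mean A B (twopt 0 x x) = x%:E.
Proof.
move=> xAB; rewrite mean_twopt// ?lexx ?ler01//; congr (_%:E); ring.
Qed.

End Optimality.

(** A strict constraint on the mean excludes the weight [p] itself; by affinity a slightly larger
    weight costs at most [eps]. *)
Lemma affine_limit (R : realType) (f : R -> R) (p V eps : R) :
  (forall t, f t = f 0 + t * (f 1 - f 0)) -> p < 1 -> f p <= V -> 0 < eps ->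
  exists t, [/\ p < t, t <= 1 & f t <= V + eps].
Proof.
move=> fE p1 fp eps0; set k := f 1 - f 0 in fE.
have k1 : 0 < `|k| + 1 by rewrite ltr_wpDl.
pose h := Num.min (1 - p) (eps / (`|k| + 1)).
have h0 : 0 < h by rewrite lt_min subr_gt0 p1 divr_gt0.
have h1 : h <= 1 - p by rewrite ge_min lexx.
have h2 : h * (`|k| + 1) <= eps by rewrite -ler_pdivlMr// ge_min lexx orbT.
exists (p + h); split; [lra|lra|].
have := ler_wpM2l (ltW h0) (ler_norm k).
by move: fp; rewrite (fE p) (fE (p + h)); lra.
Qed.

(** * Alternatives with mean equal to [mu1], or above it *)

Section Above.
Variables (R : realType) (A B mu0 mu1 : R).
Hypotheses (mu0AB : A < mu0 < B) (mu1AB : A < mu1 < B) (mu01 : mu0 < mu1).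
Notation E := (E_ mu0).
Notation aGW := (alpha_GW A B mu0 mu1).
Notation amax := (alpha_max A mu0).
Notation p := ((mu1 - A) / (B - A)).
Notation growth := (growth A B mu0).
Notation slope := (growth_slope A B mu0).

Lemma left_in_itv : A <= A <= B. Proof. by case/andP: mu0AB => ? ?; lra. Qed.
Lemma right_in_itv : A <= B <= B. Proof. by case/andP: mu0AB => ? ?; lra. Qed.
Lemma mu1_in_itv : A <= mu1 <= B.
Proof. by case/andP: mu1AB => /ltW-> /ltW->. Qed.

Lemma twopt_mean_eq : mean_eq A B mu1 (twopt p A B).
Proof.
split; first exact: twopt_probs_on left_in_itv right_in_itv.
rewrite /= (mean_twopt left_in_itv right_in_itv (weight01W mu1AB)).
congr (_%:E).
by case/andP: mu0AB => ? ?; field; rewrite gt_eqF//; lra.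
Qed.

Lemma twopt_mean_gt (t : R) : p < t -> t <= 1 -> mean_gt A B mu1 (twopt t A B).
Proof.
move=> pt t1; have /andP[p0 _] := weight01 mu1AB.
have t01 : 0 <= t <= 1 by rewrite t1 (ltW (lt_trans p0 pt)).
split; first exact: twopt_probs_on left_in_itv right_in_itv.
rewrite /= (mean_twopt left_in_itv right_in_itv t01) lte_fin.
have AB : 0 < B - A by case/andP: mu0AB => ? ?; lra.
by move: pt; rewrite ltr_pdivrMr//; lra.
Qed.

(** The chord bound for ln (E_aGW / E_0), used as an upper bound on the log-growth 0 of the constant
    1. *)
Lemma epower_aGW_ge (Q : borel_prob R) : probs_on A B Q -> mu1 <= ev A B Q id ->
  ((growth p aGW)%:E <= epower A B Q (E aGW))%E.
Proof.
move=> Q1 m1; have [GA GB] := E_aGW_gt0 mu0AB mu1AB mu01.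
have /andP[G0 _] := aGW_lt_amax mu0AB mu1AB mu01.
have [c c0 Hc] := ln_ratio_ge_affine mu1 mu0AB (lexx 0) (ltW G0) GA.
have : (epower A B Q (E 0) <=
    (ev A B Q (fun x => ln (E aGW x)) - growth p aGW)%:E)%E.
  apply: (epower_le_shift (c := c) (mu1 := mu1)) => //.
  - by case: (regular_E A B mu0 0).
  - by rewrite mulr_ge0// subr_ge0.
  - move=> x xAB; rewrite {1}E_alpha0 -expR0 ler_expR.
    by have := Hc _ xAB; rewrite growth0 E_alpha0 ln1; lra.
rewrite epower_E ?E_alpha0// ?epower_E// ln1 ev_cst// !lee_fin; lra.
Qed.

Lemma ev_mean_eq (Q : borel_prob R) : mean_eq A B mu1 Q -> ev A B Q id = mu1.
Proof. by case=> Q1 /=; rewrite meanE// => -[]. Qed.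

Lemma ev_mean_gt (Q : borel_prob R) : mean_gt A B mu1 Q -> mu1 < ev A B Q id.
Proof. by case=> Q1 /=; rewrite meanE// lte_fin. Qed.

Lemma I_aGW : I_ A B mu0 aGW.
Proof.
have /andP[G0 _] := aGW_lt_amax mu0AB mu1AB mu01.
have [GA _] := E_aGW_gt0 mu0AB mu1AB mu01.
by apply: I_nonneg => //; exact: ltW.
Qed.

Lemma I_0 : I_ A B mu0 0.
Proof. by apply: I_nonneg => //; rewrite E_alpha0 ler01. Qed.

Lemma growth_affine (a t : R) :
  growth t a = growth 0 a + t * (growth 1 a - growth 0 a).
Proof. by rewrite /growth; ring. Qed.

Lemma tangent_affine (a a' t : R) :
  growth t a + (a' - a) * slope t a
  = growth 0 a + (a' - a) * slope 0 a
    + t * (growth 1 a + (a' - a) * slope 1 a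
           - (growth 0 a + (a' - a) * slope 0 a)).
Proof. by rewrite /growth /slope; ring. Qed.

Lemma GROW_mean_eq : is_GROW A B (mean_eq A B mu0) (mean_eq A B mu1) (E aGW).
Proof.
have [GA GB] := E_aGW_gt0 mu0AB mu1AB mu01.
apply: (is_GROW_intro mu0AB (V := growth p aGW)) => //.
- by apply: evars_mean_eq_E => //; exact: I_aGW.
- by move=> Q Qm; have [Q1 _] := Qm; apply: epower_aGW_ge; rewrite ?ev_mean_eq.
- move=> a eps Ia eps0; exists p, A, B.
  (* Tangents at [aGW] replace the logs of [E a], which may vanish at an end; their average is
     constant in [a] because the slope at [aGW] is 0. *)
  exists (ln (E aGW A) + (E a A / E aGW A - 1)).
  exists (ln (E aGW B) + (E a B / E aGW B - 1)); split.
  + by rewrite left_in_itv right_in_itv weight01W.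
  + exact: twopt_mean_eq.
  + by split; exact: expR_tangent.
  + rewrite growth_tangentE// growth_slopeE// subrr mulr0 mul0r mulr0 addr0.
    by rewrite lerDl ltW.
Qed.

Lemma GROW_mean_gt : is_GROW A B (mean_le A B mu0) (mean_gt A B mu1) (E aGW).
Proof.
have [GA GB] := E_aGW_gt0 mu0AB mu1AB mu01.
have /andP[G0 _] := aGW_lt_amax mu0AB mu1AB mu01.
apply: (is_GROW_intro mu0AB (V := growth p aGW)) => //.
- exact: mean_eq_le.
- by apply: evars_mean_le_E => //; [exact: I_aGW|exact: ltW].
- move=> Q Qm; have [Q1 _] := Qm; apply: epower_aGW_ge => //.
  by rewrite ltW// ev_mean_gt.
- move=> a eps Ia eps0; have /andP[p0 p1] := weight01 mu1AB.
  have fp : growth p aGW + (a - aGW) * slope p aGW <= growth p aGW.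
    by rewrite growth_slopeE// subrr mulr0 mul0r mulr0 addr0.
  have [t [pt t1 ft]] := affine_limit (tangent_affine aGW a) p1 fp eps0.
  exists t, A, B.
  exists (ln (E aGW A) + (E a A / E aGW A - 1)).
  exists (ln (E aGW B) + (E a B / E aGW B - 1)); split.
  + by rewrite left_in_itv right_in_itv t1 (ltW (lt_trans p0 pt)).
  + exact: twopt_mean_gt.
  + by split; exact: expR_tangent.
  + by rewrite growth_tangentE.
Qed.

Lemma REGROW_mean_eq (a0 : R) : aGW < a0 -> 0 < E a0 A ->
  equalizes A B mu0 mu1 a0 ->
  is_REGROW A B (mean_eq A B mu0) (mean_eq A B mu1) (E a0).
Proof.
move=> Ga0 EA eq0; have [GA GB] := E_aGW_gt0 mu0AB mu1AB mu01.
have /andP[G0 _] := aGW_lt_amax mu0AB mu1AB mu01.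
have a00 : 0 <= a0 by rewrite ltW// (lt_trans G0).
have EB : 0 < E a0 B by exact: (E_B_gt0 mu0AB).
have E1 : 0 < E a0 mu1 by rewrite (lt_le_trans ltr01)// E_ge1// ltW.
have Em1 : 0 < E amax mu1 by apply: (E_amax_gt0 mu0AB); case/andP: mu1AB.
apply: (is_REGROW_intro mu0AB (V := growth p a0 - growth p aGW)) => //.
- by move=> Q [].
- by apply: evars_mean_eq_E => //; exact: I_0.
- by apply: evars_mean_eq_E => //; apply: I_nonneg => //; exact: ltW.
- move=> Q e Qm ee; have [Q1 _] := Qm; have [me _ _] := ee.
  have [b Ib eb] := evar_dominated mu0AB ee.
  have [c Hc] : exists c, forall x, A <= x <= B -> E b x <=
      expR (ln (E a0 x) - (growth p a0 - growth p aGW) - c * (x - mu1)).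
    have [ba|/ltW ab] := leP b a0.
      by have [c _ Hc] := E_le_below mu0AB mu1AB mu01 a00 EA ba Ib; exists c.
    (* The sign of the tangent slope does not matter, because every mean in the alternative equals
       [mu1]. *)
    rewrite -eq0; exact: E_le_above_tangent.
  apply: (epower_le_shift (c := c) (mu1 := mu1)) => //.
    by rewrite ev_mean_eq// subrr mulr0.
  by move=> x xAB; apply: le_trans (eb _ xAB) (Hc _ xAB).
- move=> a eps Ia eps0; have [aa0|/ltW a0a] := leP a a0.
  (* Slopes up to [a0] are punished by the Dirac mass at [mu1], against the rival [E amax]. *)
  + exists 0, mu1, mu1, (ln (E a0 mu1)), (ln (E a0 mu1)), (ln (E amax mu1)).
    split.
    * by rewrite mu1_in_itv lexx ler01.
    * split; first exact: twopt_probs_on mu1_in_itv mu1_in_itv.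
      by rewrite /= mean_twopt_id// mu1_in_itv.
    * apply: twopt_id_GRO => //; first exact: mu1_in_itv.
      by apply: evars_mean_eq_E => //; exact: I_amax.
    * by rewrite lnK ?posrE//; split; rewrite E_le// ltW.
    * by move: eq0; rewrite /equalizes; lra.
  (* Slopes from [a0] on are punished by the law on {A, B} with mean [mu1], against the rival
     [E aGW]. *)
  + exists p, A, B.
    exists (ln (E a0 A) + (E a A / E a0 A - 1)).
    exists (ln (E a0 B) + (E a B / E a0 B - 1)), (growth p aGW); split.
    * by rewrite left_in_itv right_in_itv weight01W.
    * exact: twopt_mean_eq.
    * have t01 := weight01W mu1AB.
      apply: GRO_twopt_ge => //; rewrite ?left_in_itv ?right_in_itv//.
      by apply: evars_mean_eq_E => //; exact: I_aGW.
    * by split; exact: expR_tangent.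
    * rewrite growth_tangentE//.
      have := growth_tangent_le mu0AB (ltW Ga0) a0a EA EB; lra.
Qed.

Lemma REGROW_mean_gt (a0 : R) : aGW < a0 -> 0 < E a0 A ->
  ln (E a0 B) - ln (E amax B) = growth p a0 - growth p aGW ->
  is_REGROW A B (mean_le A B mu0) (mean_gt A B mu1) (E a0).
Proof.
move=> Ga0 EA eq0; have [GA GB] := E_aGW_gt0 mu0AB mu1AB mu01.
have [Amu muB] := andP mu0AB; have [Amu' muB'] := andP mu1AB.
have /andP[G0 _] := aGW_lt_amax mu0AB mu1AB mu01.
have a00 : 0 <= a0 by rewrite ltW// (lt_trans G0).
have EB : 0 < E a0 B by exact: (E_B_gt0 mu0AB).
have EmB : 0 < E amax B by apply: (E_amax_gt0 mu0AB); lra.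
apply: (is_REGROW_intro mu0AB (V := growth p a0 - growth p aGW)) => //.
- exact: mean_eq_le.
- by move=> Q [].
- by apply: evars_mean_le_E => //; exact: I_0.
- by apply: evars_mean_le_E => //; apply: I_nonneg => //; exact: ltW.
- move=> Q e Qm ee; have [Q1 _] := Qm; have [me _ _] := ee.
  have [b Ib eb] := evar_dominated mu0AB (evars_sub (@mean_eq_le _ _ _ _) ee).
  have [c c0 Hc] : exists2 c, 0 <= c & forall x, A <= x <= B -> E b x <=
      expR (ln (E a0 x) - (growth p a0 - growth p aGW) - c * (x - mu1)).
    have [ba|/ltW ab] := leP b a0; first exact: E_le_below.
    (* Means exceed [mu1], so a tangent with the wrong sign of slope is excluded; the constant bound
       attained at [B] takes its place. *)
    exists 0 => // x xAB; rewrite mul0r subr0 -eq0.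
    exact: E_le_above.
  apply: (epower_le_shift (c := c) (mu1 := mu1)) => //.
    by rewrite mulr_ge0// subr_ge0 ltW// ev_mean_gt.
  by move=> x xAB; apply: le_trans (eb _ xAB) (Hc _ xAB).
- move=> a eps Ia eps0; have [aa0|/ltW a0a] := leP a a0.
  + exists 0, B, B, (ln (E a0 B)), (ln (E a0 B)), (ln (E amax B)).
    split.
    * by rewrite right_in_itv lexx ler01.
    * split; first exact: twopt_probs_on right_in_itv right_in_itv.
      by rewrite /= mean_twopt_id ?right_in_itv// lte_fin.
    * apply: twopt_id_GRO => //; first exact: right_in_itv.
      apply: evars_mean_le_E => //; first exact: I_amax.
      exact: ltW (amax_gt0 mu0AB).
    * by rewrite lnK ?posrE//; split; rewrite E_le// ltW.
    * lra.
  + have /andP[p0 p1] := weight01 mu1AB.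
    (* [f t] bounds the regret of [E a] under the law of weight [t] against the rival [E aGW]; it is
       affine in [t]. *)
    pose f t := growth t a0 + (a - a0) * slope t a0 - growth t aGW.
    have fE t : f t = f 0 + t * (f 1 - f 0).
      by rewrite /f tangent_affine [growth t aGW]growth_affine; ring.
    have fp : f p <= growth p a0 - growth p aGW.
      by rewrite lerD2r growth_tangent_le// ltW.
    have [t [pt t1 ft]] := affine_limit fE p1 fp eps0.
    have t01 : 0 <= t <= 1 by rewrite t1 (ltW (lt_trans p0 pt)).
    exists t, A, B.
    exists (ln (E a0 A) + (E a A / E a0 A - 1)).
    exists (ln (E a0 B) + (E a B / E a0 B - 1)), (growth t aGW); split.
    * by rewrite left_in_itv right_in_itv.
    * exact: twopt_mean_gt.
    * apply: GRO_twopt_ge => //; rewrite ?left_in_itv ?right_in_itv//.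
      by apply: evars_mean_le_E => //; [exact: I_aGW|exact: ltW].
    * by split; exact: expR_tangent.
    * by rewrite growth_tangentE.
Qed.

End Above.

(** * Two-sided alternatives *)

Section TwoSided.
Variables (R : realType) (A B mu0 : R).
Hypothesis mu0AB : A < mu0 < B.
Notation E := (E_ mu0).
Notation a2 := (alpha_RGW_twosided A B mu0).
Notation amax := (alpha_max A mu0).
Notation amin := (alpha_min B mu0).

(** The alternative enters only through the Dirac masses at the two ends, which is why the answers
    do not depend on [delta]. *)
Variable Q0 : set (borel_prob R).
Hypotheses (Q0P : Q0 `<=` probs_on A B)
  (Q0A : Q0 (twopt 0 A A)) (Q0B : Q0 (twopt 0 B B)).

Lemma GROW_twosided : is_GROW A B (mean_eq A B mu0) Q0 (fun=> 1).
Proof.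
have [Amu muB] := andP mu0AB.
rewrite -(E_alpha0 mu0); apply: (is_GROW_intro mu0AB (V := 0)) => //.
- by apply: evars_mean_eq_E => //; exact: I_0.
- move=> Q /Q0P Q1; rewrite epower_E ?E_alpha0// ln1 ev_cst// lexx.
(* [E a] is at most 1 at [B] when [a <= 0], and at most 1 at [A] when [0 <= a]. *)
- move=> a eps Ia eps0; have [a0|/ltW a0] := leP a 0.
  + exists 0, B, B, 0, 0; split=> //.
    * by rewrite (right_in_itv mu0AB) lexx ler01.
    * by rewrite expR0 /E_; split; nra.
    * lra.
  + exists 0, A, A, 0, 0; split=> //.
    * by rewrite (left_in_itv mu0AB) lexx ler01.
    * by rewrite expR0 /E_; split; nra.
    * lra.
Qed.

Lemma E_twosided_A : E a2 A = (B - A) / (B - mu0) / 2.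
Proof.
have [Amu muB] := andP mu0AB.
by rewrite /E_ /alpha_RGW_twosided; field; rewrite !gt_eqF//; lra.
Qed.

Lemma E_twosided_B : E a2 B = (B - A) / (mu0 - A) / 2.
Proof.
have [Amu muB] := andP mu0AB.
by rewrite /E_ /alpha_RGW_twosided; field; rewrite !gt_eqF//; lra.
Qed.

Lemma E_twosided_gt0 : 0 < E a2 A /\ 0 < E a2 B.
Proof.
have [Amu muB] := andP mu0AB.
by rewrite E_twosided_A E_twosided_B !divr_gt0//; lra.
Qed.

(** Both sides are affine in [x], so the ends suffice. The bound at [A] comes from [0 <= E a B], and
    the bound at [B] from [0 <= E a A]. *)
Lemma E_le_twosided (a x : R) : I_ A B mu0 a -> A <= x <= B ->
  E a x <= E a2 x * 2.
Proof.
have [Amu muB] := andP mu0AB.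
move=> /(I_E mu0AB)[EA EB] /andP[Ax xB].
have leA : E a A <= E a2 A * 2.
  rewrite E_twosided_A divfK// ler_pdivlMr; last lra.
  by move: EB; rewrite /E_; nra.
have leB : E a B <= E a2 B * 2.
  rewrite E_twosided_B divfK// ler_pdivlMr; last lra.
  by move: EA; rewrite /E_; nra.
have wA : 0 <= (B - x) / (B - A) by rewrite divr_ge0//; lra.
have wB : 0 <= (x - A) / (B - A) by rewrite divr_ge0//; lra.
rewrite (E_conv mu0AB a) (E_conv mu0AB a2).
by have := ler_wpM2l wA leA; have := ler_wpM2l wB leB; lra.
Qed.

Lemma aminE : amin = - (B - mu0)^-1.
Proof. by rewrite -invrN opprB. Qed.

Lemma I_amin : I_ A B mu0 amin.
Proof.
have [Amu muB] := andP mu0AB.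
rewrite aminE; apply/(I_E mu0AB); split; rewrite /E_.
  have : 0 <= (B - mu0)^-1 by rewrite invr_ge0; lra.
  by nra.
by rewrite mulNr mulVf ?subrr// gt_eqF//; lra.
Qed.

Lemma I_twosided : I_ A B mu0 a2.
Proof. by have [EA EB] := E_twosided_gt0; apply/(I_E mu0AB); rewrite !ltW. Qed.

Lemma REGROW_twosided : is_REGROW A B (mean_eq A B mu0) Q0 (E a2).
Proof.
have [Amu muB] := andP mu0AB; have [EA EB] := E_twosided_gt0.
apply: (is_REGROW_intro mu0AB (V := - ln 2)) => //.
- by apply: evars_mean_eq_E => //; exact: I_0.
- by apply: evars_mean_eq_E => //; exact: I_twosided.
- move=> Q e /Q0P Q1 ee; have [me _ _] := ee.
  have [b Ib eb] := evar_dominated mu0AB ee.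
  apply: (epower_le_shift (c := 0) (mu1 := mu0)); rewrite ?mul0r//.
  move=> x xAB; apply: le_trans (eb _ xAB) _.
  rewrite mul0r subr0 opprK expRD !lnK ?posrE//; first exact: E_le_twosided.
  exact: E_gt0 xAB.
(* The extreme slopes double the candidate at the ends, so they are the rivals that give regret - ln
   2. *)
- have EmB : E amax B = E a2 B * 2.
    by rewrite (E_amax mu0AB) E_twosided_B divfK.
  have EmA : E amin A = E a2 A * 2.
    rewrite E_twosided_A divfK// /E_ aminE; field.
    by rewrite gt_eqF//; lra.
  move=> a eps Ia eps0; have [aa2|/ltW a2a] := leP a a2.
  + exists 0, B, B, (ln (E a2 B)), (ln (E a2 B)), (ln (E amax B)).
    split=> //.
    * by rewrite (right_in_itv mu0AB) lexx ler01.
    * apply: twopt_id_GRO => //; rewrite ?(right_in_itv mu0AB) ?EmB ?mulr_gt0//.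
      by apply: evars_mean_eq_E => //; exact: I_amax.
    * by rewrite lnK ?posrE//; split; rewrite E_le// ltW.
    * by rewrite EmB lnM ?posrE//; lra.
  + exists 0, A, A, (ln (E a2 A)), (ln (E a2 A)), (ln (E amin A)).
    split=> //.
    * by rewrite (left_in_itv mu0AB) lexx ler01.
    * apply: twopt_id_GRO => //; rewrite ?(left_in_itv mu0AB) ?EmA ?mulr_gt0//.
      by apply: evars_mean_eq_E => //; exact: I_amin.
    * by rewrite lnK ?posrE//; split; exact: (E_A_le mu0AB).
    * by rewrite EmA lnM ?posrE//; lra.
Qed.

End TwoSided.

(** * The three cases assembled *)

Theorem theorem1 (R : realType) (A B mu0 mu1 : R)
    (hAB : A < B) (hmu0 : A < mu0 < B) (hmu1 : A < mu1 < B)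
    (hmu : mu0 < mu1) :
  (* (a) *)
  [/\ 0 < alpha_GW A B mu0 mu1 < alpha_max A mu0,
      is_GROW A B (mean_eq A B mu0) (mean_eq A B mu1)
        (E_ mu0 (alpha_GW A B mu0 mu1)) &
      exists alpha : R,
        unique (fun a : R =>
          [/\ I_ A B mu0 a, alpha_GW A B mu0 mu1 < a &
              F_ mu0 a (alpha_max A mu0) mu1
              = G_ A B mu0 a (alpha_GW A B mu0 mu1) mu1]) alpha /\
        is_REGROW A B (mean_eq A B mu0) (mean_eq A B mu1) (E_ mu0 alpha)] /\
  (* (b) *)
  [/\ is_GROW A B (mean_le A B mu0) (mean_gt A B mu1)
        (E_ mu0 (alpha_GW A B mu0 mu1)),
      0 < alpha_RGW_onesided A B mu0 mu1 < alpha_max A mu0 &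
      is_REGROW A B (mean_le A B mu0) (mean_gt A B mu1)
        (E_ mu0 (alpha_RGW_onesided A B mu0 mu1))] /\
  (* (c) *)
  [/\ is_GROW A B (mean_eq A B mu0) (mean_neq A B mu0) (fun=> 1),
      I_ A B mu0 (alpha_RGW_twosided A B mu0),
      is_REGROW A B (mean_eq A B mu0) (mean_neq A B mu0)
        (E_ mu0 (alpha_RGW_twosided A B mu0)) &
      forall delta : R, 0 < delta ->
        [set` `[mu0 - delta, mu0 + delta]] `<=` [set` `]A, B[] ->
        is_GROW A B (mean_eq A B mu0) (mean_far A B mu0 delta) (fun=> 1) /\
        is_REGROW A B (mean_eq A B mu0) (mean_far A B mu0 delta)
          (E_ mu0 (alpha_RGW_twosided A B mu0))].
Proof.
have [Amu muB] := andP hmu0; have [Amu' muB'] := andP hmu1.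
have lAB := left_in_itv hmu0; have rAB := right_in_itv hmu0.
have tA : probs_on A B (twopt 0 A A) := twopt_probs_on 0 lAB lAB.
have tB : probs_on A B (twopt 0 B B) := twopt_probs_on 0 rAB rAB.
have mA := mean_twopt_id lAB; have mB := mean_twopt_id rAB.
have [GW0 GWm] := andP (aGW_lt_amax hmu0 hmu1 hmu).
split; [|split].
- split; [exact: aGW_lt_amax|exact: GROW_mean_eq|].
  have [a [Ga EA eqa]] := equalizes_exists hmu0 hmu1 hmu.
  have a0 := ltW (lt_trans GW0 Ga).
  have Ia : I_ A B mu0 a by apply: I_nonneg => //; exact: ltW.
  exists a; split; last exact: REGROW_mean_eq.
  split; first by split=> //; apply/(equalizesE hmu0 hmu1 hmu).
  move=> b [Ib Gb /(equalizesE hmu0 hmu1 hmu Ib Gb)[EbA eqb]].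
  exact: (equalizes_unique hmu0 hmu1 hmu).
- have [Ga EA eqa] := onesided_equalizes hmu0 hmu1 erefl.
  split; [exact: GROW_mean_gt| |exact: REGROW_mean_gt].
  by rewrite (lt_trans GW0 Ga) (lt_amax hmu0).
- have far (Q0 : set (borel_prob R)) : Q0 `<=` probs_on A B ->
      Q0 (twopt 0 A A) -> Q0 (twopt 0 B B) ->
      is_GROW A B (mean_eq A B mu0) Q0 (fun=> 1) /\
      is_REGROW A B (mean_eq A B mu0) Q0 (E_ mu0 (alpha_RGW_twosided A B mu0)).
    by move=> QP QA QB; split; [exact: GROW_twosided|exact: REGROW_twosided].
  have [] := far (mean_neq A B mu0).
  + by move=> Q [].
  + by split=> //=; rewrite mA => -[]; lra.
  + by split=> //=; rewrite mB => -[]; lra.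
  move=> gn rn; split=> //; first exact: I_twosided.
  move=> delta d0 sub; apply: far => [Q []//||].
  + split=> //=; rewrite mA -EFinB abse_EFin lte_fin ltr_normr.
    (* The endpoint itself lies strictly inside (A, B), so [A] is at distance more than [delta] from
       [mu0]. *)
    have : [set` `]A, B[] (mu0 - delta).
      by apply: sub; rewrite /= in_itv /=; lra.
    by rewrite /= in_itv /=; lra.
  + split=> //=; rewrite mB -EFinB abse_EFin lte_fin ltr_normr.
    have : [set` `]A, B[] (mu0 + delta).
      by apply: sub; rewrite /= in_itv /=; lra.
    by rewrite /= in_itv /=; lra.
Qed.
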